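(* In the adversarial OCS setting described in the context, the OCS for AdWords satisfies, for every obliviously chosen sequence and every agent $j$, $$\mathbf{E}\Big[\Big(1-\frac{1}{B_j}\sum_{t\text{ allocated to }j}b^t_j\Big)^+\Big]\le g(y_j),$$ where $y_j=\sum_{t=1}^T\mu^t_jb^t_j/B_j$ and $$g(y)=e^{-y}\max_{\substack{y_S,y_{L1},y_{L2}\ge0\\ y_S+y_{L1}+y_{L2}=y}}\frac{1+y_S/2}{e^{y_S/2}}\Big(\frac34+\frac14\cdot\frac{1+y_{L2}/2}{e^{y_{L2}/2}}\Big)\exp\Big(-\frac{y_{L1}^2}{3y_{L1}+6y_{L2}}\Big)$$ (the last factor read as $1$ when $y_{L1}=y_{L2}=0$).
   Context: Adversarial OCS for AdWords: agents $J$ with budgets $B_j>0$; $T$ steps; at step $t$ an item with bids $b^t_j\ge0$ ($b^t_j\le B_j$) and a fractional allocation $\mu^t=(\mu^t_j)_{j\in J}$ with $\mu^t_j\ge0$, $\sum_j\mu^t_j=1$ are revealed; all these are fixed in advance by an adversary. The OCS must immediately allocate item $t$ to an agent. Type Decomposition: place in $[0,1)$ consecutive left-closed right-open intervals $I_j$ of length $\mu^t_j$ in a fixed order of $j$; sample $\eta$ uniform in $[0,\frac12)$, $\eta'=\eta+\frac12$, $\eta\in I_j$, $\eta'\in I_k$; output one-way type $j$ if $j=k$, else two-way type $\{j,k\}$. Two-Way SOCS for AdWords (stateful): on two-way type $\{j,k\}$ at step $t$: pick $m\in\{j,k\}$ uniformly; if $b^t_m\ge\frac23B_m$ mark the step with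 $m$; if it is the second step marked with $m$, select opposite w.r.t. $m$ to the first step marked with $m$ (select $m$ iff $m$ was not selected there); else select $j$ or $k$ uniformly. OCS for AdWords: each step, draw a type by Type Decomposition with fresh randomness; allocate to $j$ if one-way $j$; if two-way $\{j,k\}$ allocate to the agent selected by the Two-Way SOCS. *)

(* Defs.v *)
From HB Require Import structures.
From mathcomp Require Import all_boot all_order all_algebra.
From mathcomp Require Import all_classical all_reals all_analysis.
From mathcomp Require Import lra.

Set Implicit Arguments.
Unset Strict Implicit.
Unset Printing Implicit Defensive.

Import Order.TTheory GRing.Theory Num.Theory.
Import numFieldNormedType.Exports.

Local Open Scope classical_set_scope.
Local Open Scope ring_scope.

Section Algorithm.
Context {R : realType} {d : Order.disp_t} {J : finOrderType d}.

Inductive item_type := OneWay of J | TwoWay of J & J.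

(* The agent [j] with [x \in I_j], where the intervals [I_j] of length [mu j]
   are placed one after the other from 0 in the order of [J].  It is [None]
   only when no interval contains [x]; if [mu] is a probability vector the
   intervals cover [0, 1), so this does not happen for [0 <= x < 1]. *)
Definition agent_at (mu : J -> R) (x : R) : option J :=
  [pick j | \sum_(k | (k < j)%O) mu k <= x < \sum_(k | (k <= j)%O) mu k].

Definition type_decomposition (mu : J -> R) (eta : R) : option item_type :=
  match agent_at mu eta, agent_at mu (eta + 2^-1) with
  | Some j, Some k => Some (if j == k then OneWay j else TwoWay j k)
  | _, _ => None
  end.

(* [st m] lists, in chronological order, the steps marked with [m] so far; the
   entry of such a step tells whether [m] was selected at that step. *)
Definition socs_state := J -> seq bool.

Definition record_mark (st : socs_state) (m : J) (s : bool) : socs_state :=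
  fun i => if i == m then rcons (st i) s else st i.

(* On the two-way type {j, k}, the fair bits [pick] and [coin] draw an element
   of {j, k} (true for [j], false for [k]): [pick] draws [m], and [coin] draws
   the selection when it is uniform. *)
Definition two_way_socs (B b : J -> R) (st : socs_state) (j k : J)
    (pick coin : bool) : J * socs_state :=
  let m := if pick then j else k in
  let other := if pick then k else j in
  let unif := if coin then j else k in
  if 2 / 3 * B m <= b m then
    let a := if st m is [:: s] then (if s then other else m) else unif in
    (a, record_mark st m (a == m))
  else (unif, st).

Definition ocs_step (B b mu : J -> R) (st : socs_state)
    (eta : R) (pick coin : bool) : option J * socs_state :=
  match type_decomposition mu eta with
  | Some (OneWay j) => (Some j, st)
  | Some (TwoWay j k) =>
      let r := two_way_socs B b st j k pick coin in (Some r.1, r.2)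
  | None => (None, st)
  end.

Section Run.
Variables (B : J -> R) (b mu : nat -> J -> R).
Variables (eta : nat -> R) (pick coin : nat -> bool).

Fixpoint ocs_state (t : nat) : socs_state :=
  if t is t'.+1 then
    (ocs_step B (b t') (mu t') (ocs_state t') (eta t') (pick t') (coin t')).2
  else fun=> [::].

Definition ocs_alloc (t : nat) : option J :=
  (ocs_step B (b t) (mu t) (ocs_state t) (eta t) (pick t) (coin t)).1.

Definition unused_fraction (T : nat) (j : J) : R :=
  Num.max 0 (1 - (B j)^-1 * \sum_(t < T | ocs_alloc t == Some j) b t j).

End Run.
End Algorithm.

Section Randomness.
Context {R : realType} {d : measure_display} {Omega : measurableType d}.
Variable P : probability Omega R.

Definition mutually_independent (I : finType) (F : I -> set (set Omega)) :=
  forall (S : {set I}) (A : I -> set Omega),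
    (forall i, i \in S -> F i (A i)) ->
    P (\bigcap_(i in [set i | i \in S]) A i) = (\prod_(i in S) P (A i))%E.

Definition sigma_of (d' : measure_display) (E : measurableType d')
    (X : Omega -> E) : set (set Omega) :=
  [set X @^-1` A | A in measurable].

Lemma half_interval : (0 : R) < 2^-1.
Proof. by rewrite invr_gt0 ltr0n. Qed.

Definition fresh_randomness (T : nat) (eta : nat -> {RV P >-> R})
    (pick coin : nat -> {RV P >-> bool}) : Prop :=
  [/\ (* [uniform_prob] is carried by [0, 1/2], whose right endpoint is null,
         so this is the uniform law on [0, 1/2) *)
      forall t, (t < T)%N -> forall A, measurable A ->
        distribution P (eta t) A = uniform_prob half_interval A,
      forall t, (t < T)%N ->
        distribution P (pick t) [set true] = (2^-1)%:E,
      forall t, (t < T)%N ->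
        distribution P (coin t) [set true] = (2^-1)%:E &
      mutually_independent (fun i : 'I_T + 'I_T + 'I_T =>
        match i with
        | inl (inl t) => sigma_of (eta t)
        | inl (inr t) => sigma_of (pick t)
        | inr t => sigma_of (coin t)
        end)].

End Randomness.

Section Bound.
Context {R : realType}.
Implicit Types y : R.

Definition decay (x : R) : R := (1 + x / 2) / expR (x / 2).

(* Division by zero yields 0, so the last factor is 1 if [yL1 = yL2 = 0]. *)
Definition g_objective (yS yL1 yL2 : R) : R :=
  decay yS * (3 / 4 + 1 / 4 * decay yL2) *
  expR (- (yL1 ^+ 2 / (3 * yL1 + 6 * yL2))).

Definition g_values y : set R :=
  [set v | exists yS yL1 yL2 : R,
     [/\ 0 <= yS, 0 <= yL1, 0 <= yL2, yS + yL1 + yL2 = y &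
         v = g_objective yS yL1 yL2]].

(* For [0 <= y] this supremum is a maximum, see [g_values_sup] below. *)
Definition g y : R := expR (- y) * sup (g_values y).

Lemma decay_continuous : continuous decay.
Proof.
move=> x; rewrite /decay; apply: cvgM.
  by apply: cvgD; [exact: cvg_cst | apply: cvgM; [exact: cvg_id | exact: cvg_cst]].
apply: cvgV; first by rewrite gt_eqF// expR_gt0.
apply: continuous_comp; last exact: continuous_expR.
by apply: cvgM; [exact: cvg_id | exact: cvg_cst].
Qed.

Let phi (p : R * R) : R := p.1 ^+ 2 / (3 * `|p.1| + 6 * `|p.2|).

Let phi_continuous : continuous phi.
Proof.
move=> p; have [p0|p0] := eqVneq (3 * `|p.1| + 6 * `|p.2|) 0; last first.
  apply: cvgM.
    by rewrite /phi; under eq_fun do rewrite expr2; apply: cvgM; exact: cvg_fst.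
  apply: cvgV => //.
  by apply: cvgD; apply: cvgM; (try exact: cvg_cst); apply: cvg_norm;
    [exact: cvg_fst | exact: cvg_snd].
have h1 := normr_ge0 p.1; have h2 := normr_ge0 p.2.
have p10 : p.1 = 0 by apply/normr0_eq0; lra.
have phip : phi p = 0 by rewrite /phi p10 expr0n mul0r.
rewrite /prop_for /continuous_at phip.
have bnd q : 0 <= phi q <= `|q.1|.
  rewrite /phi; have := normr_ge0 q.1; have := normr_ge0 q.2 => ? ?.
  have [q0|q0] := eqVneq (3 * `|q.1| + 6 * `|q.2|) 0.
    by rewrite q0 invr0 mulr0 lexx.
  have {}q0 : 0 < 3 * `|q.1| + 6 * `|q.2| by rewrite lt_neqAle eq_sym q0; lra.
  rewrite divr_ge0 ?sqr_ge0 ?(ltW q0)//= ler_pdivrMr// -real_normK ?num_real//.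
  by rewrite expr2; apply: ler_wpM2l => //; lra.
apply: (@squeeze_cvgr _ _ _ _ (cst 0) (fun q : R * R => `|q.1|)).
- by near=> q; exact: bnd.
- exact: cvg_cst.
- rewrite -(normr0 R) -p10; apply: cvg_norm; exact: cvg_fst.
Unshelve. all: by end_near.
Qed.

Lemma g_values_max y : 0 <= y ->
  exists2 v, g_values y v & forall w, g_values y w -> w <= v.
Proof.
move=> y0.
pose A : set (R * R) :=
  (`[0, y] `*` `[0, y]) `&` [set p | p.1 + p.2 <= y].
pose f (p : R * R) := decay (y - p.1 - p.2) * (3 / 4 + 1 / 4 * decay p.2) *
  expR (- phi p).
have cA : compact A.
  apply: compact_closedI; first by apply: compact_setX; exact: segment_compact.
  have -> : [set p : R * R | p.1 + p.2 <= y] =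
      (fun p : R * R => p.1 + p.2) @^-1` [set x | x <= y] by [].
  apply: preimage_closed; last exact: closed_le.
  by move=> p _; apply: cvgD; [exact: cvg_fst | exact: cvg_snd].
have cf : continuous f.
  move=> p; apply: cvgM; [apply: cvgM|].
  - apply: (@continuous_comp _ _ _ (fun p : R * R => y - p.1 - p.2) decay).
      apply: cvgB; last exact: cvg_snd.
      by apply: cvgB; [exact: cvg_cst | exact: cvg_fst].
    exact: decay_continuous.
  - apply: cvgD; first exact: cvg_cst.
    apply: cvgM; first exact: cvg_cst.
    by apply: (@continuous_comp _ _ _ (@snd R R) decay);
      [exact: cvg_snd | exact: decay_continuous].
  - apply: (@continuous_comp _ _ _ (fun p => - phi p) (@expR R)).
      by apply: cvgN; exact: phi_continuous.
    exact: continuous_expR.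
have fE (a b : R) : 0 <= a -> 0 <= b -> f (a, b) = g_objective (y - a - b) a b.
  by move=> a0 b0; rewrite /f /phi /g_objective /= !ger0_norm.
have A0 : A !=set0.
  by exists (0, 0); rewrite /A /= !in_itv /= addr0 !lexx !y0.
have [[a b] + fmax] := compact_EVT_max A0 cA (continuous_subspaceT cf).
rewrite inE /A /= !in_itv /= => -[[/andP[a0 ay] /andP[b0 yb]] aby].
exists (f (a, b)).
  exists (y - a - b), a, b; split => //; [lra | lra | exact: fE].
move=> _ [s [p [q [s0 p0 q0 spq ->]]]].
have -> : s = y - p - q by lra.
rewrite -fE//; apply: fmax; rewrite inE /A /= !in_itv /=.
by split; [split; apply/andP; split; lra | lra].
Qed.

Lemma g_values_sup y : 0 <= y ->
  g_values y (sup (g_values y)) /\ ubound (g_values y) (sup (g_values y)).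
Proof.
move=> /g_values_max[v gv vmax].
suff -> : sup (g_values y) = v by split.
apply/eqP; rewrite eq_le; apply/andP; split.
  by apply: ge_sup; [exists v | exact: vmax].
by apply: ub_le_sup => //; exists v; exact: vmax.
Qed.

End Bound.

(* Main.v *)
(** Fix the agent [j]. The randomness of a step is first reduced to a finite
product space, on which the expectation is a backward recursion.

A step marked with [k <> j] as the second one can only correlate negatively, as
far as [j] is concerned, with the first step marked with [k]. Since the unused
fraction is a convex function of the load, replacing these selections by fresh
coins increases the expectation; only the marks of [j] itself are kept.

In the relaxed process let [p] and [2 c] be the probabilities of a one-way and
of a two-way type with [j], and [x] the bid divided by the budget. By convexity
a small bid ([x < 2/3]) may be replaced by [2/3] with probability [3 x / 2], and
a large bid by [1] with probability [x]; the remaining budget is then [1], [1/3]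
or [0]. A small bid costs a factor bounded by the Poisson limit [decay]. Two
large steps marked with [j] leave the budget intact with probability
[1 - (x + x') / 2 <= 3/4 (1 - x/2) (1 - x'/2)], that is 3/4 of the independent
value, which yields the factor [3/4 + 1/4 decay]. Finally [p > 0] forces
[p + 2 c = 1], so that large one-way steps gain [exp (- p ^+ 2 x / 3)], and
Cauchy-Schwarz gives the last factor of [g_objective]. *)

Require Import Defs.
From mathcomp Require Import all_boot all_order all_algebra.
From mathcomp Require Import all_classical all_reals all_analysis.
From mathcomp Require Import measurable_realfun ring lra.

Set Implicit Arguments.
Unset Strict Implicit.
Unset Printing Implicit Defensive.

Import Order.TTheory GRing.Theory Num.Theory.
Import numFieldNormedType.Exports.

Local Open Scope classical_set_scope.
Local Open Scope ring_scope.

(** * Exponential bounds *)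

Section ExponentialBounds.
Context {R : realType}.
Implicit Types u v s x p q b c : R.

(** The derivative is nonpositive on the whole line. Comparison with [f 0 = 1] then bounds [1 - u]
    from above for [u >= 0] and, at [u = - s], [1 + s] from below. *)
Let f u := (1 - u) * expR (u + u ^+ 2 / 2).

Let df u : is_derive u 1 f (- u ^+ 2 * expR (u + u ^+ 2 / 2)).
Proof.
apply: is_derive_eq; rewrite /GRing.scale /= !mulr0 add0r mulr1 add0r mul1r; lra.
Qed.

Let f_noninc u v : u <= v -> f v <= f u.
Proof.
move=> uv.
apply: (@ler0_derive1_le_cc _ f u v) => //; rewrite ?in_itv /= ?lexx ?uv//.
- move=> x _; rewrite derive1E (@derive_val _ _ _ _ _ _ _ (df x)).
  by rewrite mulNr oppr_le0 mulr_ge0 ?sqr_ge0 ?expR_ge0.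
- apply: continuous_subspaceT => x.
  by apply: differentiable_continuous; apply/derivable1_diffP; have [] := df x.
Qed.

Lemma subr1_le_expR u : 0 <= u -> 1 - u <= expR (- u - u ^+ 2 / 2).
Proof.
move=> u0; have := f_noninc u0; rewrite /f subr0 mul1r expr0n /= mul0r addr0 expR0.
by rewrite -ler_pdivlMr ?expR_gt0// mul1r -expRN opprD.
Qed.

Lemma addr1_ge_expR s : 0 <= s -> expR (s - s ^+ 2 / 2) <= 1 + s.
Proof.
move=> s0; have /f_noninc : - s <= 0 by rewrite oppr_le0.
rewrite /f subr0 mul1r expr0n /= mul0r addr0 expR0 opprK sqrrN.
rewrite -ler_pdivrMr ?expR_gt0// mul1r -expRN.
by rewrite opprD opprK.
Qed.

(** [1 - v] is at most [expR (- v - v ^+ 2 / 2)] and [1 + x / 2] is at least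
    [expR (x / 2 - x ^+ 2 / 8)]; the hypothesis compares the exponents. *)
Lemma subr1_le_decay v x z : 0 <= v -> 0 <= x ->
  z + x + x ^+ 2 / 8 <= v + v ^+ 2 / 2 ->
  1 - v <= expR (- z - 3 / 2 * x) * (1 + x / 2).
Proof.
move=> v0 x0 vxz.
apply: (le_trans (subr1_le_expR v0)).
have h : expR (x / 2 - (x / 2) ^+ 2 / 2) <= 1 + x / 2.
  by apply: addr1_ge_expR; lra.
apply: le_trans (ler_wpM2l (expR_ge0 _) h).
rewrite -expRD ler_expR.
have -> : (x / 2) ^+ 2 / 2 = x ^+ 2 / 8 by field.
lra.
Qed.

Lemma subr1_le_small x : 0 <= x -> 1 - x <= expR (- (3 / 2 * x)) * (1 + x / 2).
Proof.
move=> x0; have := @subr1_le_decay x x 0 x0 x0; rewrite oppr0 sub0r => -> //.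
by rewrite add0r lerD2l; have := sqr_ge0 x; lra.
Qed.

(* [p], [2 c]: probabilities of a one-way and of a two-way type; [b]: a large bid. *)
Lemma survive_le_decay p c b :
  0 <= p -> 0 <= c -> p + 2 * c <= 1 -> p = 0 \/ p + 2 * c = 1 ->
  2 / 3 <= b -> b <= 1 ->
 
  1 - p * b - c * b <= expR (- (p * b + p ^+ 2 * b / 3) - 3 / 2 * (c * b)) * (1 + c * b / 2).
Proof.
move=> p0 c0 pc p_or b23 b1.
set z := p * b + p ^+ 2 * b / 3; set x := c * b.
have pb0 : 0 <= p * b by rewrite mulr_ge0//; lra.
have cb0 : 0 <= x by rewrite mulr_ge0//; lra.
rewrite -addrA -opprD; apply: subr1_le_decay => //; first by apply: addr_ge0.
rewrite /z /x; case: p_or => [->|h].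
  have := sqr_ge0 (c * b); nra.
(* Now [p + c = (1 + p) / 2]. After division by [b] the claim is linear and nondecreasing in [b],
   and at [b = 2 / 3] it reduces to [0 <= (1 - p) * (13 * p + 3)]. The case [p = 1] is tight, which
   accounts for the [3] in [p ^+ 2 * b / 3]. *)
have -> : c = (1 - p) / 2 by lra.
suff : 0 <= b * (b * (1 + p) ^+ 2 / 8 - b * (1 - p) ^+ 2 / 32 - p ^+ 2 / 3) by nra.
rewrite mulr_ge0//; first lra.
have : 0 <= (b - 2 / 3) * (4 * (1 + p) ^+ 2 - (1 - p) ^+ 2).
  rewrite mulr_ge0//; first lra.
  have : 0 <= (1 + 3 * p) * (3 + p) by rewrite mulr_ge0//; lra.
  lra.
have : 0 <= (1 - p) * (13 * p + 3) by rewrite mulr_ge0//; lra.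
nra.
Qed.

(** The left side is the factor of a large step without its part marked with the agent:
    [1 - p - 2 * c], plus [p * (1 - b)], plus [c * (1 - b / 2)] for the two-way steps marked with
    the other agent. As [c * b <= c], it is at most [1 - (p * b + 3 / 2 * (c * b))]. *)
Lemma unmarked_survive_le p c b :
  0 <= p -> 0 <= c -> p + 2 * c <= 1 -> p = 0 \/ p + 2 * c = 1 ->
  2 / 3 <= b -> b <= 1 ->
 
  1 - p * b - c - c * b / 2 <= expR (- (p * b + p ^+ 2 * b / 3) - 3 / 2 * (c * b)).
Proof.
move=> p0 c0 pc p_or b23 b1.
set z := p * b + p ^+ 2 * b / 3; set x := c * b.
have pb0 : 0 <= p * b by rewrite mulr_ge0//; lra.
have cb0 : 0 <= x by rewrite mulr_ge0//; lra.
have xc : x <= c by rewrite /x; nra.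
apply: (@le_trans _ _ (1 - (p * b + 3 / 2 * x))); first by rewrite /x in xc *; lra.
have u0 : 0 <= p * b + 3 / 2 * x by lra.
apply: (le_trans (subr1_le_expR u0)); rewrite ler_expR /z.
case: p_or => [->|h].
  rewrite !expr2 !mul0r !add0r oppr0 add0r.
  have := sqr_ge0 (3 / 2 * x); rewrite expr2; lra.
suff : p ^+ 2 * b / 3 <= (p * b + 3 / 2 * x) ^+ 2 / 2 by lra.
rewrite /x; have -> : c = (1 - p) / 2 by lra.
(* The bracket is nondecreasing in [b], and at [b = 2 / 3] it is a positive multiple of
   [(1 - p) * (3 + 5 * p)]. *)
suff : 0 <= b * (b * (3 + p) ^+ 2 / 32 - p ^+ 2 / 3) by nra.
rewrite mulr_ge0//; first lra.
have : 0 <= (b - 2 / 3) * (3 + p) ^+ 2.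
  by rewrite mulr_ge0 ?sqr_ge0//; lra.
have : 0 <= (1 - p) * (1 + p) by rewrite mulr_ge0//; lra.
nra.
Qed.

Lemma survive_le p c b :
  0 <= p -> 0 <= c -> p + 2 * c <= 1 -> p = 0 \/ p + 2 * c = 1 ->
  2 / 3 <= b -> b <= 1 ->
  1 - p * b - c * b <= expR (- (p * b + p ^+ 2 * b / 3) - c * b).
Proof.
move=> p0 c0 pc p_or b23 b1.
set z := p * b + p ^+ 2 * b / 3; set x := c * b.
apply: (le_trans (survive_le_decay p0 c0 pc p_or b23 b1)); rewrite -/z -/x.
have -> : - z - x = (- z - 3 / 2 * x) + x / 2 by lra.
by rewrite [leRHS]expRD ler_wpM2l ?expR_ge0// expR_ge1Dx.
Qed.

End ExponentialBounds.

(** * The relaxed process *)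

Section RelaxedValue.
Context {R : realType}.
Implicit Types (f : R -> R) (w : R -> seq bool -> R) (r be : R).
Implicit Types a x y u v h k l p c q G Z A D X Y K E e : R.

Definition convexf f := forall x y a, 0 <= a <= 1 ->
  f (a * x + (1 - a) * y) <= a * f x + (1 - a) * f y.

Lemma convexf_shift f h : convexf f -> convexf (fun r => f (r - h)).
Proof.
move=> cf x y a a01.
have -> : a * x + (1 - a) * y - h = a * (x - h) + (1 - a) * (y - h) by ring.
exact: cf.
Qed.

Lemma convexfD f1 f2 : convexf f1 -> convexf f2 -> convexf (fun r => f1 r + f2 r).
Proof. by move=> c1 c2 x y a a01; have := c1 x y a a01; have := c2 x y a a01; lra. Qed.

Lemma convexfZ k f : 0 <= k -> convexf f -> convexf (fun r => k * f r).
Proof.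
move=> k0 cf x y a a01; rewrite !(mulrCA _ k) -mulrDr.
by rewrite ler_wpM2l//; exact: cf.
Qed.

Lemma convexf_max0 : convexf (fun r => Num.max 0 r).
Proof.
move=> x y a /andP[a0 a1]; rewrite ge_max; apply/andP; split.
  by rewrite addr_ge0// mulr_ge0 ?subr_ge0// le_max lexx.
by rewrite lerD// ler_wpM2l ?subr_ge0// le_max lexx orbT.
Qed.

(** The points [u - h] and [v] lie between [v - h] and [u] and have the same sum, so they are convex
    combinations of these two with complementary weights [l] and [1 - l]. *)
Lemma convexf_exchange f u v h : convexf f -> v <= u -> 0 <= h ->
  f (u - h) + f v <= f u + f (v - h).
Proof.
move=> cf vu h0; have [e|ne] := eqVneq (u - v + h) 0.
  have -> : h = 0 by lra.
  by rewrite !subr0 addrC.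
have l0 : 0 < u - v + h by rewrite lt_neqAle eq_sym ne /=; lra.
set l := h / (u - v + h).
have l01 : 0 <= l <= 1.
  by rewrite /l divr_ge0 ?(ltW l0)//= ler_pdivrMr// mul1r; lra.
have el : l * (u - v + h) = h by rewrite /l divfK.
have := cf (v - h) u l l01; have := cf u (v - h) l l01.
have -> : l * (v - h) + (1 - l) * u = u - l * (u - v + h) by ring.
have -> : l * u + (1 - l) * (v - h) = v - h + l * (u - v + h) by ring.
rewrite el subrK; lra.
Qed.

(* [js] lists the steps marked with the fixed agent; [w] is the value after the
   current step, [be] the bid at this step. *)
Definition fair_step w be r js := (w (r - be) js + w r js) / 2.

Definition mark_step w be r js :=
  match js with
  | [:: s] => if s then w r (rcons js false) else w (r - be) (rcons js true)
  | _ => (w (r - be) (rcons js true) + w r (rcons js false)) / 2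
  end.

(* [p], [c]: probability of a one-way type and half the probability of a
   two-way type containing the fixed agent. *)
Definition relaxed_step (p c be : R) w r js :=
  (1 - p - 2 * c) * w r js + p * w (r - be) js +
  c * (fair_step w be r js +
       if 2 / 3 <= be then mark_step w be r js else fair_step w be r js).

(** Convexity lets a bid be replaced by a random one with the same mean; vanishing at an exhausted
    budget anchors the chord, so that values after a bid become multiples of values before it. *)
Definition good w :=
  (forall js, convexf (w ^~ js)) /\ (forall r js, r <= 0 -> w r js = 0).

Lemma good_relaxed_step p c be w : 0 <= p -> 0 <= c -> p + 2 * c <= 1 ->
  0 <= be -> good w -> good (relaxed_step p c be w).
Proof.
move=> p0 c0 pc be0 [cw zw].
have z r js : r <= 0 -> w (r - be) js = 0 by move=> r0; apply: zw; lra.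
split=> [js|r js r0]; last first.
  rewrite /relaxed_step /fair_step !z// !zw//.
  have -> : mark_step w be r js = 0.
    by case: js => [|s [|? ?]] /=; rewrite ?z ?zw//; [lra | case: s | lra].
  by case: ifP => _; lra.
have half (f1 f2 : R -> R) : convexf f1 -> convexf f2 ->
    convexf (fun r => (f1 r + f2 r) / 2).
  move=> c1 c2; have := convexfZ (k := 2^-1) _ (convexfD c1 c2).
  by under eq_fun do rewrite mulrC; apply; rewrite invr_ge0.
have fair : convexf (fun r => fair_step w be r js).
  by apply: half; [exact: (convexf_shift be (cw js)) | exact: cw].
apply: convexfD; last apply: convexfZ => //; last apply: convexfD => //.
  apply: convexfD; first by apply: convexfZ => //; lra.
  by apply: convexfZ => //; exact: (convexf_shift be (cw js)).
case: (2 / 3 <= be) => //.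
have sh js' : convexf (fun r => w (r - be) js') by exact: (convexf_shift be (cw js')).
by case: js fair => [|[] [|? ?]] _ //=; try apply: half => //.
Qed.

(* Right after the first mark, at a large bid [be], the states [:: true] and
   [:: false] carry the relative weights [1 - be] and [1]; hence [l <= 1 / 4]. *)
Definition level_bound w r G Z A D :=
  [/\ forall js, (1 < size js)%N -> w r js <= G * Z,
      forall l, 0 <= l <= 1 / 4 ->
        l * w r [:: true] + (1 - l) * w r [:: false] <=
        G * (3 / 4 * Z + 1 / 4 * A) &
      w r [::] <= G * (3 / 4 * Z + 1 / 4 * D)].

(** A bid of the whole budget with probability [be] replaces [be]; since [r - 1 <= 0], nothing is
    left after it. *)
Lemma large_bid_le w r be js : good w -> r <= 1 -> 0 <= be <= 1 ->
  w (r - be) js <= (1 - be) * w r js.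
Proof.
move=> [cw zw] r1 be01; have := cw js (r - 1) r be be01.
rewrite (zw (r - 1)); last by lra.
have -> : be * (r - 1) + (1 - be) * r = r - be by ring.
lra.
Qed.

(** The point [r - be] divides the segment from [r] to [r - 2 / 3] with weight [3 / 2 * be]. All
    small bids then have the common size [2 / 3], so only the budgets 1 and 1/3 occur before
    exhaustion. *)
Lemma small_bid_le w r be js : good w -> 0 <= be -> be <= 2 / 3 ->
  w (r - be) js <= (1 - 3 / 2 * be) * w r js + 3 / 2 * be * w (r - 2 / 3) js.
Proof.
move=> [cw _] be0 be23; have := cw js (r - 2 / 3) r (3 / 2 * be).
have -> : 3 / 2 * be * (r - 2 / 3) + (1 - 3 / 2 * be) * r = r - be by field.
by move=> h; apply: (le_trans (h _)); lra.
Qed.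

Lemma small_step_le p c be w r js : 0 <= p -> 0 <= c ->
  0 <= be -> be < 2 / 3 -> good w ->
  relaxed_step p c be w r js <=
  (1 - 3 / 2 * ((p + c) * be)) * w r js +
  3 / 2 * ((p + c) * be) * w (r - 2 / 3) js.
Proof.
move=> p0 c0 be0 be23 gw.
have := @small_bid_le w r be js gw be0 (ltW be23) => h.
rewrite /relaxed_step /fair_step [2 / 3 <= be]leNgt be23 /=.
have := ler_wpM2l (addr_ge0 p0 c0) h; lra.
Qed.

(** A small bid sets no mark, so all three bounds are mixed with the same weights from the budgets
    [r] and [r - 2 / 3], and only the factor [G] changes. *)
Lemma level_bound_small_step p c be w r G G' G2 Z A D : 0 <= p -> 0 <= c ->
  p + c <= 1 -> 0 <= be -> be < 2 / 3 -> 0 <= Z -> 0 <= A -> 0 <= D -> good w ->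
  level_bound w r G Z A D -> level_bound w (r - 2 / 3) G2 Z A D ->
  (1 - 3 / 2 * ((p + c) * be)) * G + 3 / 2 * ((p + c) * be) * G2 <= G' ->
  level_bound (relaxed_step p c be w) r G' Z A D.
Proof.
move=> p0 c0 pc be0 be23 Z0 A0 D0 gw [h2 h1 h0] [k2 k1 k0] GG.
set q := 3 / 2 * ((p + c) * be) in GG *.
have q0 : 0 <= q by rewrite !mulr_ge0//; lra.
have q1 : q <= 1.
  have : (p + c) * be <= 1 * (2 / 3) by rewrite ler_pM ?addr_ge0//; lra.
  by rewrite /q; lra.
have st js := small_step_le r js p0 c0 be0 be23 gw; rewrite -/q in st; clearbody q.
have mix X Y K : 0 <= K -> X <= G * K -> Y <= G2 * K ->
    (1 - q) * X + q * Y <= G' * K.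
  move=> K0 XK YK; apply: (@le_trans _ _ (((1 - q) * G + q * G2) * K)); last first.
    by rewrite ler_wpM2r.
  by rewrite [leRHS]mulrDl -!mulrA; apply: lerD; rewrite ler_wpM2l//; lra.
split=> [js sjs|l l01|].
- by apply: (le_trans (st js)); apply: mix; rewrite ?h2 ?k2.
- have l0 : 0 <= l by lra.
  have l1 : 0 <= 1 - l by lra.
  have := mix _ _ _ _ (h1 l l01) (k1 l l01) => /(_ ltac:(lra)).
  have := ler_wpM2l l0 (st [:: true]); have := ler_wpM2l l1 (st [:: false]).
  set X := relaxed_step _ _ _ _ _ _; set Y := relaxed_step _ _ _ _ _ _; lra.
- by apply: (le_trans (st [::])); apply: mix => //; lra.
Qed.

(** [Z], [A] and [D] majorize the value under independent selections, counting respectively all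
    outcomes, those without a further mark, and those with at most one. Outcomes reaching a second
    mark are reduced to 3/4, whence [3 / 4 * Z + 1 / 4 * A] after one mark and
    [3 / 4 * Z + 1 / 4 * D] at the start. *)
Lemma level_bound_large_step p c be w r G Z A D Z' A' D' :
  0 <= p -> 0 <= c -> p + 2 * c <= 1 -> 2 / 3 <= be -> be <= 1 ->
  r <= 1 -> 0 <= G -> 0 <= Z -> good w ->
  level_bound w r G Z A D ->
  (1 - p * be - c * be) * Z <= Z' ->
  (1 - p * be - c - c * be / 2) * A <= A' ->
  (1 - p * be - c - c * be / 2) * D + c * (1 - be / 2) * A <= D' ->
  level_bound (relaxed_step p c be w) r G Z' A' D'.
Proof.
move=> p0 c0 pc be23 be1 r1 G0 Z0 gw [h2 h1 h0] hZ hA hD.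
have be01 : 0 <= be <= 1 by lra.
have lb js : w (r - be) js <= (1 - be) * w r js := large_bid_le js gw r1 be01.
(* The factor of the step without its part marked with the agent; adding [c * (1 - be / 2)] for a
   fair selection at that part gives [1 - p * be - c * be]. *)
set al := 1 - p * be - c - c * be / 2 in hA hD *.
have al0 : 0 <= al.
  have : p * be <= p * 1 by rewrite ler_wpM2l.
  have : c * be <= c * 1 by rewrite ler_wpM2l.
  rewrite /al; lra.
have st js : relaxed_step p c be w r js <= al * w r js + c * mark_step w be r js.
  rewrite /relaxed_step /fair_step be23.
  have := ler_wpM2l p0 (lb js); have := ler_wpM2l c0 (lb js); rewrite /al; lra.
have GM X Y : X <= Y -> G * X <= G * Y by apply: ler_wpM2l.
split=> [js sjs|l l01|].
- apply: (le_trans (st js)).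
  have -> : mark_step w be r js =
    (w (r - be) (rcons js true) + w r (rcons js false)) / 2.
    by case: js sjs => [|? [|? ?]].
  have s2 s : (1 < size (rcons js s))%N by rewrite size_rcons ltnW.
  have := h2 _ sjs; have := lb (rcons js true).
  have := h2 _ (s2 true); have := h2 _ (s2 false).
  set X := w r (rcons js true); set Y := w r (rcons js false).
  move=> hY hX lbX hw.
  have a1 : (1 - be) * X <= (1 - be) * (G * Z) by rewrite ler_wpM2l//; lra.
  have a2 : al * w r js <= al * (G * Z) by rewrite ler_wpM2l.
  have a3 : c * ((w (r - be) (rcons js true) + Y) / 2) <=
            c * (((1 - be) * (G * Z) + G * Z) / 2) by rewrite ler_wpM2l//; lra.
  have := GM _ _ hZ; rewrite /al in a2 *; lra.
- have l0 : 0 <= l by lra.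
  have l1 : 0 <= 1 - l by lra.
  have := ler_wpM2l l0 (st [:: true]); have := ler_wpM2l l1 (st [:: false]).
  set X := relaxed_step _ _ _ _ _ _; set Y := relaxed_step _ _ _ _ _ _.
  have := ler_wpM2l al0 (h1 _ l01).
  have t1 : w r [:: true; false] <= G * Z by rewrite h2.
  have t2 : w (r - be) [:: false; true] <= (1 - be) * (G * Z).
    by apply: (le_trans (lb _)); rewrite ler_wpM2l ?h2//; lra.
  have := ler_wpM2l (mulr_ge0 c0 l0) t1; have := ler_wpM2l (mulr_ge0 c0 l1) t2.
  have GZ0 : 0 <= G * Z by rewrite mulr_ge0.
  (* The second mark: after [true] the agent is not selected, after [false] it is. At [l = 1 / 4]
     the left side is [1 - 3 / 4 * be], which is at most the right side exactly when [be >= 2 / 3];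
     this is the role of the threshold for marking. *)
  have key : l + (1 - l) * (1 - be) <= 3 / 4 * (1 - be / 2).
    have : 0 <= be * (1 / 4 - l) by rewrite mulr_ge0//; lra.
    lra.
  have := ler_wpM2l (mulr_ge0 c0 GZ0) key.
  have := GM _ _ hZ; have := GM _ _ hA; rewrite /al /=; lra.
- apply: (le_trans (st [::])) => /=.
  (* The weights [1 - be] and [1] of the two outcomes of a first mark, normalized; [l] reaches
     [1 / 4] at [be = 2 / 3]. Their total, times [c / 2], is the coefficient [c * (1 - be / 2)] of
     [A] in the bound on [D']. *)
  set l := (1 - be) / (2 - be).
  have e2 : 2 - be != 0 by rewrite gt_eqF//; lra.
  have el : l * (2 - be) = 1 - be by rewrite /l divfK.
  have l01 : 0 <= l <= 1 / 4.
    by rewrite /l divr_ge0 ?ler_pdivrMr; lra.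
  have m0 : 0 <= c * (1 - be / 2) by rewrite mulr_ge0//; lra.
  have := ler_wpM2l m0 (h1 l l01).
  have -> : c * (1 - be / 2) * (l * w r [:: true] + (1 - l) * w r [:: false]) =
    c / 2 * ((l * (2 - be)) * w r [:: true] +
     (2 - be - l * (2 - be)) * w r [:: false]) by field.
  rewrite el => a1.
  have a2 := ler_wpM2l c0 (lb [:: true]).
  have a3 := ler_wpM2l al0 h0.
  have := GM _ _ hZ; have := GM _ _ hD; rewrite /al in a3 *; lra.
Qed.

(** * Backward induction over the steps of the relaxed process *)

Variables p c be : nat -> R.

Fixpoint relaxed_value n t : R -> seq bool -> R :=
  if n is n'.+1 then relaxed_step (p t) (c t) (be t) (relaxed_value n' t.+1)
  else fun r _ => Num.max 0 r.

Definition suffix_sum (F : nat -> R) n t := \sum_(i < n) F (t + i)%N.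

Lemma suffix_sum0 F t : suffix_sum F 0 t = 0.
Proof. by rewrite /suffix_sum big_ord0. Qed.

Lemma suffix_sumS F n t : suffix_sum F n.+1 t = F t + suffix_sum F n t.+1.
Proof.
rewrite /suffix_sum big_ord_recl addn0; congr (_ + _).
by apply: eq_bigr => i _; rewrite lift0 addnS.
Qed.

Let large t := 2 / 3 <= be t.
Definition small_load t := if large t then 0 else (p t + c t) * be t.
Definition one_way_load t := if large t then p t * be t else 0.
Definition two_way_load t := if large t then c t * be t else 0.
(** The exponent that [survive_le] and its companions gain beyond the load. *)
Definition one_way_gain t := if large t then p t ^+ 2 * be t / 3 else 0.

Let ys n t := suffix_sum small_load n t.
Let yz n t := suffix_sum (fun i => one_way_load i + one_way_gain i) n t.
Let y2 n t := suffix_sum two_way_load n t.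

(** The dichotomy on [p t] reflects the geometry of the type decomposition; see
    [one_way_prob_or]. *)
Definition valid_step t := [/\ 0 <= p t, 0 <= c t, p t + 2 * c t <= 1,
  p t = 0 \/ p t + 2 * c t = 1 & 0 <= be t <= 1].

Lemma good_relaxed_value n t :
  (forall i, (t <= i < t + n)%N -> valid_step i) -> good (relaxed_value n t).
Proof.
elim: n t => [|n IH] t vs /=.
  split=> [js|r js r0]; first exact: convexf_max0.
  by apply/max_idPl.
have [p0 c0 pc _ /andP[be0 _]] : valid_step t.
  by apply: vs; rewrite leqnn -[ltnLHS]addn0 ltn_add2l.
apply: good_relaxed_step => //; apply: IH => i /andP[ti it]; apply: vs.
by rewrite (ltnW ti) -addSnnS.
Qed.

Lemma suffix_sum_ge0 F n t : (forall i, (t <= i < t + n)%N -> 0 <= F i) ->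
  0 <= suffix_sum F n t.
Proof.
by move=> F0; apply: sumr_ge0 => i _; apply: F0; rewrite leq_addr ltn_add2l ltn_ord.
Qed.

(** The budgets 1 and 1/3 are treated together, since a small loss leads from the first to the
    second and from the second to exhaustion. The factors are Poisson expectations: with mean
    [3 / 2 * s] small losses, no loss leaves 1 and one loss leaves 1/3, giving
    [expR (- (3 / 2 * s)) * (1 + s / 2)]. *)
Lemma relaxed_value_bound n t :
  (forall i, (t <= i < t + n)%N -> valid_step i) ->
  let E := expR (- yz n t - 3 / 2 * y2 n t) in
  let B := fun r G => level_bound (relaxed_value n t) r G
     (expR (- yz n t - y2 n t)) E (E * (1 + y2 n t / 2)) in
  B 1 (expR (- (3 / 2 * ys n t)) * (1 + ys n t / 2)) /\
  B (1 / 3) (1 / 3 * expR (- (3 / 2 * ys n t))).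
Proof.
elim: n t => [|n IH] t vs /=.
  rewrite /ys /yz /y2 !suffix_sum0 !(oppr0, mulr0, mul0r, subr0, addr0, expR0, mulr1).
  rewrite /level_bound /=.
  have -> : Num.max 0 1 = 1 :> R by apply/max_idPr.
  have -> : Num.max 0 (1 / 3) = 1 / 3 :> R by apply/max_idPr; lra.
  by split; split=> *; lra.
have vst : valid_step t by apply: vs; rewrite leqnn -[ltnLHS]addn0 ltn_add2l.
have {}vs i : (t.+1 <= i < t.+1 + n)%N -> valid_step i.
  by move=> /andP[ti it]; apply: vs; rewrite (ltnW ti) -addSnnS.
have gw := good_relaxed_value vs.
have [I1 I3] := IH _ vs; move: vst => [p0 c0 pc por /andP[be0 be1]].
have s0 : 0 <= ys n t.+1.
  apply: suffix_sum_ge0 => i /vs[pi0 ci0 _ _ /andP[bi0 _]]; rewrite /small_load.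
  by case: ifP => _ //; rewrite mulr_ge0// addr_ge0.
have x0 : 0 <= y2 n t.+1.
  apply: suffix_sum_ge0 => i /vs[pi0 ci0 _ _ /andP[bi0 _]]; rewrite /two_way_load.
  by case: ifP => _ //; rewrite mulr_ge0.
rewrite /ys /yz /y2 !suffix_sumS -/(ys n _) -/(yz n _) -/(y2 n _).
move: (ys n t.+1) (yz n t.+1) (y2 n t.+1) s0 x0 I1 I3 => s z x s0 x0 I1 I3.
rewrite /small_load /one_way_load /one_way_gain /two_way_load.
rewrite /large; have [L|L] := boolP (2 / 3 <= be t).
- rewrite add0r; set zt := p t * be t + _; set xt := c t * be t.
  have sE := survive_le p0 c0 pc por L be1.
  have sA := unmarked_survive_le p0 c0 pc por L be1.
  have sD := survive_le_decay p0 c0 pc por L be1.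
  rewrite -/zt -/xt in sE sA sD.
  have eZ : expR (- (zt + z) - (xt + x)) = expR (- zt - xt) * expR (- z - x).
    by rewrite -expRD; congr expR; ring.
  have eA : expR (- (zt + z) - 3 / 2 * (xt + x)) =
      expR (- zt - 3 / 2 * xt) * expR (- z - 3 / 2 * x).
    by rewrite -expRD; congr expR; ring.
  rewrite eZ eA.
  have step r G : r <= 1 -> 0 <= G -> level_bound (relaxed_value n t.+1) r G
       (expR (- z - x)) (expR (- z - 3 / 2 * x)) (expR (- z - 3 / 2 * x) * (1 + x / 2)) ->
     level_bound (relaxed_step (p t) (c t) (be t) (relaxed_value n t.+1)) r G
       (expR (- zt - xt) * expR (- z - x))
       (expR (- zt - 3 / 2 * xt) * expR (- z - 3 / 2 * x))
       (expR (- zt - 3 / 2 * xt) * expR (- z - 3 / 2 * x) * (1 + (xt + x) / 2)).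
    move=> r1 G0 lb.
    apply: (level_bound_large_step p0 c0 pc L be1 r1 G0 (expR_ge0 _) gw lb).
    + by rewrite ler_wpM2r ?expR_ge0.
    + by rewrite ler_wpM2r ?expR_ge0.
    (* The terms in [E] alone add up to the factor [1 - p * be - c * be], bounded by [sD]; the
       remaining term in [E * (x / 2)] is bounded by [sA]. *)
    + set E := expR (- z - _); set e := expR (- zt - _) in sA sD *.
      have h1 := ler_wpM2r (expR_ge0 (- z - 3 / 2 * x)) sD; rewrite -/E in h1.
      have Ex : 0 <= E * (x / 2) by rewrite mulr_ge0 ?expR_ge0//; lra.
      have h2 := ler_wpM2r Ex sA.
      rewrite /xt in h1 h2 *; lra.
  split; apply: step => //; rewrite ?mulr_ge0 ?expR_ge0//; lra.
- rewrite addr0 !add0r; set m := (p t + c t) * be t.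
  have {}L : be t < 2 / 3 by rewrite ltNge.
  have m0 : 0 <= m by rewrite mulr_ge0// addr_ge0.
  have es : expR (- (3 / 2 * (m + s))) = expR (- (3 / 2 * m)) * expR (- (3 / 2 * s)).
    by rewrite -expRD; congr expR; ring.
  have E0 := @expR_ge0 R.
  have pc1 : p t + c t <= 1 by lra.
  have x2 : 0 <= 1 + x / 2 by lra.
  have e1 := expR_ge1Dx (- (3 / 2 * m)).
  have e2 := subr1_le_small m0.
  rewrite es; split.
    have e3 : 1 - 2 / 3 = 1 / 3 :> R by lra.
    move: (I3); rewrite -e3 => I3'.
    have := level_bound_small_step p0 c0 pc1 be0 L (E0 _) (E0 _) (mulr_ge0 (E0 _) x2) gw I1 I3'.
    (* Apart from [F] the mixture is [(1 - m) + (1 - 3 / 2 * m) * (s / 2)]; [e2] bounds the first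
       summand and [e1] the second. *)
    apply; rewrite -/m; set F := expR (- (3 / 2 * s)).
    have F0 : 0 <= F by apply: E0.
    have h1 := ler_wpM2r F0 e2.
    have Fs : 0 <= F * (s / 2) by rewrite mulr_ge0//; lra.
    have h2 := ler_wpM2r Fs e1.
    lra.
  (* From 1/3 a small loss exhausts the budget, so the bound holds there with the factor 0. *)
  have I0 : level_bound (relaxed_value n t.+1) (1 / 3 - 2 / 3) 0
      (expR (- z - x)) (expR (- z - 3 / 2 * x)) (expR (- z - 3 / 2 * x) * (1 + x / 2)).
    have z0 js : relaxed_value n t.+1 (1 / 3 - 2 / 3) js = 0 by apply: gw.2; lra.
    by split=> *; rewrite !z0; lra.
  apply: (level_bound_small_step p0 c0 pc1 be0 L (E0 _) (E0 _) (mulr_ge0 (E0 _) x2) gw I3 I0).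
  rewrite -/m; set F := expR (- (3 / 2 * s)).
  have F0 : 0 <= F by apply: E0.
  have h2 := ler_wpM2r F0 e1; lra.
Qed.

(** The loads of small, large one-way and large two-way steps form one of the decompositions over
    which [g] maximizes. It remains to bound the total gain from below by the exponent in the last
    factor of [g_objective]. *)
Lemma relaxed_value_le n :
  (forall i, (i < n)%N -> valid_step i) ->
  relaxed_value n 0 1 [::] <= g (\sum_(i < n) (p i + c i) * be i).
Proof.
move=> vs.
have /relaxed_value_bound : forall i, (0 <= i < 0 + n)%N -> valid_step i by move=> i /=; apply: vs.
move=> /= [[_ _ h] _]; apply: (le_trans h) => {h}.
set s := ys n 0; set z := yz n 0; set x := y2 n 0.
have ge0 F : (forall i, valid_step i -> 0 <= F i) -> 0 <= suffix_sum F n 0.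
  by move=> F0; apply: suffix_sum_ge0 => i /= /vs /F0.
have s0 : 0 <= s.
  apply: ge0 => i [pi0 ci0 _ _ /andP[bi0 _]]; rewrite /small_load.
  by case: ifP => _ //; rewrite mulr_ge0// addr_ge0.
have x0 : 0 <= x.
  apply: ge0 => i [pi0 ci0 _ _ /andP[bi0 _]]; rewrite /two_way_load.
  by case: ifP => _ //; rewrite mulr_ge0.
pose y1 := suffix_sum one_way_load n 0.
pose q := suffix_sum one_way_gain n 0.
have y10 : 0 <= y1.
  apply: ge0 => i [pi0 ci0 _ _ /andP[bi0 _]]; rewrite /one_way_load.
  by case: ifP => _ //; rewrite mulr_ge0.
have ez : z = y1 + q by rewrite /z /yz /suffix_sum big_split.
have ey : \sum_(i < n) (p i + c i) * be i = s + y1 + x.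
  rewrite /s /y1 /x /ys /y2 /suffix_sum -!big_split /=; apply: eq_bigr => i _.
  rewrite add0n /small_load /one_way_load /two_way_load; case: ifP => _; ring.
(* Cauchy-Schwarz, as [p = 0] or [p + 2 c = 1] at each step *)
have cs : y1 ^+ 2 / (3 * y1 + 6 * x) <= q.
  have [d0|dn0] := eqVneq (3 * y1 + 6 * x) 0.
    rewrite d0 invr0 mulr0; apply: ge0 => i [pi0 ci0 _ _ /andP[bi0 _]].
    by rewrite /one_way_gain; case: ifP => _ //; rewrite !mulr_ge0 ?sqr_ge0// invr_ge0.
  have d0 : 0 < 3 * y1 + 6 * x by rewrite lt_neqAle eq_sym dn0 /=; lra.
  (* The minimizer of the quadratic below. In it a large step contributes [(p - k) ^+ 2 * be] if
     [p + 2 * c = 1], and [2 * k ^+ 2 * c * be] if [p = 0]. *)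
  pose k := y1 / (y1 + 2 * x).
  have : 0 <= 3 * q - 2 * k * y1 + k ^+ 2 * (y1 + 2 * x).
    rewrite /q /y1 /x /y2 /suffix_sum !mulr_sumr -sumrN -!big_split /=.
    rewrite mulr_sumr -big_split /=.
    apply: sumr_ge0 => i _; rewrite add0n.
    have [pi0 ci0 pc por /andP[bi0 _]] := vs _ (ltn_ord i).
    rewrite /one_way_gain /one_way_load /two_way_load; case: ifP => _; last by lra.
    case: por => [->|h].
      have : 0 <= k ^+ 2 * (c i * be i).
        by apply: mulr_ge0; [exact: sqr_ge0 | exact: mulr_ge0].
      lra.
    have -> : c i = (1 - p i) / 2 by lra.
    have : 0 <= (p i - k) ^+ 2 * be i.
      by apply: mulr_ge0; [exact: sqr_ge0 | exact: bi0].
    lra.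
  have d1 : y1 + 2 * x != 0 by rewrite gt_eqF//; lra.
  have -> : k ^+ 2 * (y1 + 2 * x) = k * y1.
    by rewrite expr2 -mulrA [k * (_ + _)]divfK.
  have -> : y1 ^+ 2 / (3 * y1 + 6 * x) = k * y1 / 3.
    by rewrite /k; field; rewrite d1.
  lra.
have y0 : 0 <= s + y1 + x by lra.
have [_ ub] := g_values_sup y0.
rewrite ey /g; apply: le_trans (ler_wpM2l (expR_ge0 _) (ub _ _)); last first.
  by exists s, y1, x; split; rewrite // addrA.
rewrite /g_objective /decay.
have -> : expR (- (3 / 2 * s)) = expR (- s) / expR (s / 2).
  by rewrite -expRN -expRD; congr expR; field.
have -> : expR (- z - 3 / 2 * x) = expR (- z - x) / expR (x / 2).
  by rewrite -expRN -expRD; congr expR; field.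
have -> : - (s + y1 + x) = - s + (- y1 - x) by ring.
rewrite (expRD (- s)).
set es := expR (s / 2); set ex := expR (x / 2).
have es0 : 0 < es := expR_gt0 _.
have ex0 : 0 < ex := expR_gt0 _.
set K := (1 + s / 2) / es; set H := 3 / 4 + 1 / 4 * ((1 + x / 2) / ex).
have K0 : 0 <= K by rewrite mulr_ge0 ?invr_ge0 ?(ltW es0)//; lra.
have H0 : 0 <= H.
  by rewrite addr_ge0// ?mulr_ge0 ?invr_ge0 ?(ltW ex0)//; lra.
have -> : expR (- s) / es * (1 + s / 2) *
  (3 / 4 * expR (- z - x) + 1 / 4 * (expR (- z - x) / ex * (1 + x / 2))) =
  expR (- s) * K * H * expR (- z - x) by rewrite /K /H; ring.
have -> : forall e, expR (- s) * expR (- y1 - x) * (K * H * e) =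
  expR (- s) * K * H * (expR (- y1 - x) * e) by move=> e; ring.
apply: ler_wpM2l; first by apply: mulr_ge0 => //; apply: mulr_ge0 => //; exact: expR_ge0.
rewrite -expRD ler_expR ez; lra.
Qed.

End RelaxedValue.

(** * Comparison with the relaxed process *)

Section SetAt.
Context {I : finType} {K : Type}.
Implicit Types (s : {ffun I -> K}) (i k : I) (u v : K).

Definition set_at s k v : {ffun I -> K} := [ffun i => if i == k then v else s i].

Lemma set_atE s k v i : set_at s k v i = if i == k then v else s i.
Proof. by rewrite ffunE. Qed.

Lemma set_atC s k l u v : k != l ->
  set_at (set_at s k u) l v = set_at (set_at s l v) k u.
Proof.
move=> kl; apply/ffunP => i; rewrite !set_atE.
by case: eqP => // ->; rewrite eq_sym (negPf kl).
Qed.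

Lemma set_atK s k u v : set_at (set_at s k u) k v = set_at s k v.
Proof. by apply/ffunP => i; rewrite !set_atE; case: eqP. Qed.

Lemma set_at_id s k : set_at s k (s k) = s.
Proof. by apply/ffunP => i; rewrite set_atE; case: eqP => // ->. Qed.

End SetAt.

(** Flipping the bit [k] is an involution, so the sum equals its average with the flipped sum. *)
Lemma sum_resample_bit (R : realType) (J : finType) (k : J) (F : {ffun J -> bool} -> R) :
  \sum_s F s = \sum_s (F (set_at s k true) + F (set_at s k false)) / 2.
Proof.
pose fl (s : {ffun J -> bool}) := set_at s k (~~ s k).
have flK : involutive fl.
  by move=> s; rewrite /fl set_atK set_atE eqxx negbK set_at_id.
have e : \sum_s F s = \sum_s F (fl s) by rewrite (reindex_inj (inv_inj flK)).
rewrite -mulr_suml; apply: (canRL (mulfK _)) => //.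
rewrite mulr_natr mulr2n {2}e -big_split /=; apply: eq_bigr => s _.
rewrite /fl -{1}(set_at_id s k); case: (s k) => //=.
by rewrite addrC.
Qed.


Section DiscreteProcess.
Context {R : realType} {d : Order.disp_t} {J : finOrderType d}.
Variables (B : J -> R) (j : J).
Implicit Types (b : J -> R) (st : socs_state (J := J)) (r : R) (js : seq bool).
Implicit Types (V : R -> socs_state (J := J) -> R) (W : R -> seq bool -> R).

Definition loss b (o : option J) : R := if o == Some j then (B j)^-1 * b j else 0.

(** A step depends on [eta] only through the pair of agents found at [eta] and [eta + 1/2], which
    ranges over a finite type. *)
Definition discrete_step b st (a : option J * option J) (pick coin : bool) :
    option J * socs_state :=
  match a with
  | (Some i, Some k) =>
      if i == k then (Some i, st)
      else let r := two_way_socs B b st i k pick coin in (Some r.1, r.2)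
  | _ => (None, st)
  end.

Lemma ocs_stepE b mu st eta pick coin : ocs_step B b mu st eta pick coin =
  discrete_step b st (agent_at mu eta, agent_at mu (eta + 2^-1)) pick coin.
Proof.
rewrite /ocs_step /type_decomposition /discrete_step.
by case: (agent_at mu eta) => // i; case: (agent_at _ _) => // k; case: eqP.
Qed.

Definition next_value b V r st a pick coin :=
  let o := discrete_step b st a pick coin in V (r - loss b o.1) o.2.

Definition exact_step b (q : option J * option J -> R) V r st :=
  \sum_a q a * ((\sum_(pick : bool) \sum_(coin : bool)
                   next_value b V r st a pick coin) / 4).

(** * One step: the correlations caused by other agents give way to fresh coins *)

Section Relaxation.
Variable b : J -> R.
Let be := (B j)^-1 * b j.
Let large m := 2 / 3 * B m <= b m.
Implicit Types (rho : {ffun J -> bool} -> R).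
Implicit Types (sts : {ffun J -> bool} -> socs_state (J := J)).

(* The value of a two-way step on {m, o} given that [m] is picked, averaged
   over the coin. *)
Definition socs_value V r st m o :=
  if large m then
    if st m is [:: s] then
      V (r - loss b (Some (if s then o else m))) (record_mark st m (~~ s))
    else (V (r - loss b (Some m)) (record_mark st m true) +
          V (r - loss b (Some o)) (record_mark st m false)) / 2
  else (V (r - loss b (Some m)) st + V (r - loss b (Some o)) st) / 2.

Lemma two_way_value V r st i k (pick : bool) : i != k ->
  \sum_(coin : bool) next_value b V r st (Some i, Some k) pick coin =
  2 * socs_value V r st (if pick then i else k) (if pick then k else i).
Proof.
move=> ik; rewrite big_bool /next_value /discrete_step (negPf ik) /two_way_socs /socs_value.
have ki : (k == i) = false by rewrite eq_sym (negPf ik).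
rewrite -/(large _).
case: pick => /=; case: ifP => _ /=; try lra.
- case: (st i) => [|s [|? ?]] /=; rewrite ?eqxx ?ki; [lra| |lra].
  by case: s; rewrite /= ?eqxx ?ki; lra.
- case: (st k) => [|s [|? ?]] /=; rewrite ?eqxx ?(negPf ik); [lra| |lra].
  by case: s; rewrite /= ?eqxx ?(negPf ik); lra.
Qed.

(* The bits [s] are averaged over.  In the second alternative [s k] tells whether
   [k] was selected at the only step marked with [k] so far; the remaining budget
   [rho] of [j] can then only increase with [s k]. *)
Definition admissible (rho : {ffun J -> bool} -> R)
    (sts : {ffun J -> bool} -> socs_state (J := J)) js :=
  (forall s, sts s j = js) /\
  forall k, k != j ->
    (exists l, [/\ size l != 1%N, forall s, sts s k = l &
                   forall s v, rho (set_at s k v) = rho s]) \/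
    ((forall s, sts s k = [:: s k]) /\
     forall s, rho (set_at s k false) <= rho (set_at s k true)).

(** The comparison holds only on average over the bits: for a fixed first selection of another
    agent, the opposite second selection may be the worse one for the fixed agent. *)
Definition dominated V W := forall rho sts js, admissible rho sts js ->
  \sum_s V (rho s) (sts s) <= \sum_s W (rho s) js.

Lemma admissible_shift rho sts js h :
  admissible rho sts js -> admissible (fun s => rho s - h) sts js.
Proof.
move=> [aj ak]; split=> // k /ak [[l [l1 stl rl]]|[stk rk]].
  by left; exists l; split=> // s v; rewrite rl.
by right; split=> // s; rewrite lerD2r.
Qed.

Lemma admissible_record_self rho sts js v : admissible rho sts js ->
  admissible rho (fun s => record_mark (sts s) j v) (rcons js v).
Proof.
move=> [aj ak]; split=> [s|k kj]; first by rewrite /record_mark eqxx aj.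
have [[l [l1 stl rl]]|[stk rk]] := ak k kj.
  by left; exists l; split=> // s; rewrite /record_mark (negPf kj).
by right; split=> // s; rewrite /record_mark (negPf kj).
Qed.

Lemma admissible_record_many rho sts js m l v : m != j ->
  (1 < size l)%N -> (forall s, sts s m = l) ->
  admissible rho sts js -> admissible rho (fun s => record_mark (sts s) m v) js.
Proof.
move=> mj l2 stm [aj ak]; split=> [s|k kj].
  by rewrite /record_mark eq_sym (negPf mj) aj.
have [->|km] := eqVneq k m.
  have [[l' [l1 stl rl]]|[stk rk]] := ak m mj; last first.
    pose s0 : {ffun J -> bool} := [ffun=> true].
    by move: l2; rewrite -(stm s0) stk.
  left; exists (rcons l v); split=> // [|s]; last by rewrite /record_mark eqxx stm.
  by rewrite size_rcons eqSS gtn_eqF// ltnW.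
have [[l' [l1 stl rl]]|[stk rk]] := ak k kj.
  by left; exists l'; split=> // s; rewrite /record_mark (negPf km).
by right; split=> // s; rewrite /record_mark (negPf km).
Qed.

(** Before the step the bit [s m] is fresh and becomes the outcome of the coin. The loss [h] is
    incurred when [m] is not selected, so the remaining budget increases with this bit. *)
Lemma admissible_record_first rho sts js m h : m != j -> 0 <= h ->
  (forall s, sts s m = [::]) -> admissible rho sts js ->
  admissible (fun s => rho s - if s m then 0 else h)
             (fun s => record_mark (sts s) m (s m)) js.
Proof.
move=> mj h0 stm [aj ak]; split=> [s|k kj].
  by rewrite /record_mark eq_sym (negPf mj) aj.
have [->|km] := eqVneq k m.
  have [[l' [l1 stl rl]]|[stk rk]] := ak m mj; last first.
    pose s0 : {ffun J -> bool} := [ffun=> true].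
    by have := stm s0; rewrite stk.
  right; split=> s; first by rewrite /record_mark eqxx stm.
  by rewrite !set_atE eqxx !rl; lra.
have mk : (m == k) = false by rewrite eq_sym (negPf km).
have [[l' [l1 stl rl]]|[stk rk]] := ak k kj.
  left; exists l'; split=> // s; first by rewrite /record_mark (negPf km).
  by move=> v; rewrite rl set_atE mk.
right; split=> // s; first by rewrite /record_mark (negPf km).
by rewrite !set_atE mk lerD2r.
Qed.

(** Once the bit of [m] is fixed to [u], the list of [m] is the constant [[:: u; v]] and the budget
    no longer varies with the bit: [m] passes to the first alternative. *)
Lemma admissible_record_second rho sts js m u v : m != j ->
  (forall s, sts s m = [:: s m]) -> admissible rho sts js ->
  admissible (fun s => rho (set_at s m u))
             (fun s => record_mark (sts (set_at s m u)) m v) js.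
Proof.
move=> mj stm [aj ak]; split=> [s|k kj].
  by rewrite /record_mark eq_sym (negPf mj) aj.
have [->|km] := eqVneq k m.
  left; exists [:: u; v]; split=> // s; last by move=> w; rewrite set_atK.
  by rewrite /record_mark eqxx stm set_atE eqxx.
have mk : m != k by rewrite eq_sym.
have [[l' [l1 stl rl]]|[stk rk]] := ak k kj.
  left; exists l'; split=> // s; first by rewrite /record_mark (negPf km).
  by move=> w; rewrite set_atC// rl.
right; split=> // s; first by rewrite /record_mark (negPf km) stk set_atE (negPf km).
by rewrite !(set_atC s _ _ km).
Qed.

Hypothesis be_ge0 : 0 <= be.

Let loss_ge0 o : 0 <= loss b o.
Proof. by rewrite /loss; case: ifP. Qed.

Let loss_other m : m != j -> loss b (Some m) = 0.
Proof. by move=> mj; rewrite /loss; case: ifP mj => // /eqP[->]; rewrite eqxx. Qed.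

Let loss_self : loss b (Some j) = be.
Proof. by rewrite /loss eqxx. Qed.

Definition relaxed_pair_value W r js m o :=
  if (m == j) || (o == j) then
    if (m == j) && large j then mark_step W be r js else fair_step W be r js
  else W r js.

Lemma fair_pair W r js m o : m != o ->
  (W (r - loss b (Some m)) js + W (r - loss b (Some o)) js) / 2 =
  if (m == j) || (o == j) then fair_step W be r js else W r js.
Proof.
rewrite /fair_step; have [-> jo|mj mo] := eqVneq m j.
  by rewrite loss_self loss_other 1?eq_sym// subr0.
rewrite (loss_other mj) subr0; have [->|oj] := eqVneq o j.
  by rewrite loss_self addrC.
by rewrite loss_other// subr0; field.
Qed.

(** A mark of [j] is treated alike in both processes. A mark of another agent acts as a fair coin,
    except at its second occurrence, where convexity favors the fair coin. *)
Lemma socs_value_dominated V W rho sts js m o : good W -> dominated V W ->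
  m != o -> admissible rho sts js ->
  \sum_s socs_value V (rho s) (sts s) m o <=
  \sum_s relaxed_pair_value W (rho s) js m o.
Proof.
move=> [cW _] dom mo adm.
have half (F G F' G' : {ffun J -> bool} -> R) : \sum_s F s <= \sum_s F' s ->
    \sum_s G s <= \sum_s G' s ->
    \sum_s (F s + G s) / 2 <= \sum_s (F' s + G' s) / 2.
  by move=> h1 h2; rewrite -!mulr_suml !big_split /=; lra.
have avg js' : admissible rho sts js' ->
    \sum_s (V (rho s - loss b (Some m)) (sts s) +
            V (rho s - loss b (Some o)) (sts s)) / 2 <=
    \sum_s (if (m == j) || (o == j) then fair_step W be (rho s) js'
            else W (rho s) js').
  move=> adm'; under [leRHS]eq_bigr do rewrite -fair_pair//.
  by apply: half; apply: dom; apply: admissible_shift.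
rewrite /socs_value /relaxed_pair_value.
case: (boolP (large m)) => [Lm|Lm]; last first.
  have -> : (m == j) && large j = false by case: eqP => // <-; rewrite (negPf Lm).
  exact: avg.
have [mj|mj] := eqVneq m j.
  subst m; rewrite Lm /=.
  have st0 s : sts s j = js by apply: adm.1.
  under eq_bigr do rewrite st0.
  have oj : o != j by rewrite eq_sym.
  rewrite loss_self loss_other//.
  have dj v h : \sum_s V (rho s - h) (record_mark (sts s) j v) <=
      \sum_s W (rho s - h) (rcons js v).
    by apply: dom; apply: admissible_shift; apply: admissible_record_self.
  case: js {st0 adm avg} dj => [|s0 [|s1 js]] dj.
  - apply: half; first exact: dj.
    by have := dj false 0; under [leRHS]eq_bigr do rewrite subr0.
  - case: s0 dj => dj /=.
      rewrite loss_other//.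
      by have := dj false 0; under [leRHS]eq_bigr do rewrite subr0.
    by rewrite loss_self; exact: dj.
  - apply: half; first exact: dj.
    by have := dj false 0; under [leRHS]eq_bigr do rewrite subr0.
rewrite /=; have fp r : (W r js + W (r - loss b (Some o)) js) / 2 =
    if o == j then fair_step W be r js else W r js.
  by have := fair_pair W r js mo; rewrite (loss_other mj) subr0 (negPf mj).
have [[l [l1 stl rl]]|[stm rm]] := adm.2 m mj.
  under eq_bigr do rewrite stl.
  case: l l1 stl => [|s0 [|s1 l]] // _ stl.
  (* First mark with [m]: neither [rho] nor [sts] depends on the bit [s m], which therefore can
     serve as the coin of this step. *)
  - have adm1 := admissible_record_first mj (loss_ge0 (Some o)) stl adm.
    have stm s v : sts (set_at s m v) = sts s.
      apply/funext => k; have [->|kj] := eqVneq k j; first by rewrite !adm.1.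
      have [->|km] := eqVneq k m; first by rewrite !stl.
      have [[l' [_ stl' _]]|[stk _]] := adm.2 k kj; first by rewrite !stl'.
      by rewrite !stk set_atE (negPf km).
    have := dom _ _ _ adm1; set lhs := (X in X <= _ -> _); set rhs := (X in _ <= X -> _).
    have -> : lhs = \sum_s (V (rho s - loss b (Some m)) (record_mark (sts s) m true) +
          V (rho s - loss b (Some o)) (record_mark (sts s) m false)) / 2.
      rewrite /lhs (sum_resample_bit m); apply: eq_bigr => s _.
      by rewrite !stm !rl !set_atE !eqxx (loss_other mj).
    move=> h; apply: (le_trans h); rewrite /rhs (sum_resample_bit m).
    apply: ler_sum => s _; rewrite !rl !set_atE !eqxx.
    by rewrite -fp subr0.
  - under [leRHS]eq_bigr do rewrite -fp -[in W (rho _) js](subr0 (rho _)).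
    rewrite (loss_other mj).
    by apply: half; apply: dom; apply: admissible_shift;
      apply: (admissible_record_many _ _ _ stl).
(* Second mark with [m]: the loss falls on the case [s m = true], where the remaining budget is
   larger. By [convexf_exchange], moving it to the smaller budget does not decrease the sum, and a
   fair coin averages the two placements. *)
rewrite [leLHS](sum_resample_bit m).
under [leLHS]eq_bigr do rewrite !stm !set_atE !eqxx /=.
have d1 u v h : \sum_s V (rho (set_at s m u) - h)
                         (record_mark (sts (set_at s m u)) m v) <=
                \sum_s W (rho (set_at s m u) - h) js.
  apply: dom; apply: (@admissible_shift (fun s => rho (set_at s m u))).
  exact: (admissible_record_second u v mj stm adm).
have dT := d1 true false (loss b (Some o)); have dF := d1 false true (loss b (Some m)).
apply: (le_trans (half _ _ _ _ dT dF)).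
under [leRHS]eq_bigr do rewrite -fp.
rewrite [leRHS](sum_resample_bit m) (loss_other mj).
apply: ler_sum => s _; rewrite subr0.
have := convexf_exchange (cW js) (rm s) (loss_ge0 (Some o)); lra.
Qed.

Definition one_way (a : option J * option J) := a == (Some j, Some j).
Definition two_way (a : option J * option J) :=
  if a is (Some i, Some k) then (i != k) && ((i == j) || (k == j)) else false.

Definition relaxed_type_value W r js a :=
  if one_way a then W (r - be) js
  else if two_way a then
    (fair_step W be r js +
     if large j then mark_step W be r js else fair_step W be r js) / 2
  else W r js.


Lemma type_value_dominated V W rho sts js a : good W -> dominated V W ->
  admissible rho sts js ->
  \sum_s (\sum_(pick : bool) \sum_(coin : bool)
            next_value b V (rho s) (sts s) a pick coin) / 4 <=
  \sum_s relaxed_type_value W (rho s) js a.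
Proof.
move=> gW dom adm; rewrite /relaxed_type_value /one_way /two_way.
have idle o :
    (forall s pick coin, next_value b V (rho s) (sts s) a pick coin =
       V (rho s - loss b o) (sts s)) ->
    \sum_s (\sum_(pick : bool) \sum_(coin : bool)
            next_value b V (rho s) (sts s) a pick coin) / 4 <=
    \sum_s W (rho s - loss b o) js.
  move=> e; under eq_bigr do rewrite !big_bool !e.
  apply: le_trans (dom _ _ _ (admissible_shift (loss b o) adm)).
  by apply: ler_sum => s _ /=; lra.
have loss_None : loss b None = 0 by rewrite /loss.
case: a idle => [[i|] [k|]] idle /=; last 3 first.
1-3: apply: (le_trans (idle None _)) => //; rewrite loss_None; apply: ler_sum => s _.
1-3: by rewrite subr0 //; case: ifP => // /eqP.
have [ik|ik] := eqVneq i k.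
  subst k; rewrite -[_ == _]/((i == j) && (i == j)) andbb /=.
  apply: (le_trans (idle (Some i) _)); first by move=> *; rewrite /next_value /= eqxx.
  have [->|ij] := eqVneq i j; first by rewrite loss_self.
  by rewrite (loss_other ij); under [leLHS]eq_bigr do rewrite subr0.
have -> : ((Some i, Some k) == (Some j, Some j)) = false.
  by apply/eqP => -[ij kj]; rewrite ij kj eqxx in ik.
under [leLHS]eq_bigr do rewrite big_bool !two_way_value//.
have h1 := socs_value_dominated gW dom ik adm.
have h2 : k != i by rewrite eq_sym.
have {}h2 := socs_value_dominated gW dom h2 adm.
apply: (@le_trans _ _ ((\sum_s relaxed_pair_value W (rho s) js i k +
                        \sum_s relaxed_pair_value W (rho s) js k i) / 2)).
  apply: le_trans (_ : (\sum_s socs_value V (rho s) (sts s) i k +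
                        \sum_s socs_value V (rho s) (sts s) k i) / 2 <= _); last by lra.
  by rewrite -big_split /= mulr_suml; apply: ler_sum => s _ /=; lra.
rewrite -big_split /= mulr_suml; apply: ler_sum => s _.
rewrite /relaxed_pair_value.
have [ij|ij] := eqVneq i j; have [kj|kj] := eqVneq k j => /=.
- by rewrite ij kj eqxx in ik.
- by case: ifP => _; lra.
- by case: ifP => _; lra.
- by lra.
Qed.

Definition one_way_prob (q : option J * option J -> R) := q (Some j, Some j).
Definition half_two_way_prob (q : option J * option J -> R) :=
  (\sum_(a | two_way a) q a) / 2.

Lemma sum_relaxed_type_value W q r js : (\sum_a q a = 1) -> large j = (2 / 3 <= be) ->
  \sum_a q a * relaxed_type_value W r js a =
  relaxed_step (one_way_prob q) (half_two_way_prob q) be W r js.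
Proof.
move=> q1 lj; rewrite /relaxed_step /one_way_prob /half_two_way_prob -lj.
set jj := (Some j, Some j); set H := fair_step _ _ _ _ + _.
have tw : two_way jj = false by rewrite /two_way /jj eqxx.
(* [W r js] is taken as the baseline of every type, and the types involving [j] contribute
   differences to it. *)
have e a : q a * relaxed_type_value W r js a = q a * W r js +
   (if one_way a then q a * (W (r - be) js - W r js) else 0) +
   (if two_way a then q a * (H / 2 - W r js) else 0).
  rewrite /relaxed_type_value -/H; case: ifP => [/eqP->|_]; first by rewrite tw; ring.
  by case: ifP => _; ring.
under eq_bigr do rewrite e.
rewrite !big_split /= -mulr_suml q1 -!big_mkcond /= big_pred1_eq -mulr_suml.
lra.
Qed.

End Relaxation.

Lemma exact_step_dominated b q V W : 0 <= (B j)^-1 * b j ->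
  (2 / 3 * B j <= b j) = (2 / 3 <= (B j)^-1 * b j) ->
  (forall a, 0 <= q a) -> \sum_a q a = 1 -> good W -> dominated V W ->
  dominated (exact_step b q V)
    (relaxed_step (one_way_prob q) (half_two_way_prob q) ((B j)^-1 * b j) W).
Proof.
move=> be0 lj q0 q1 gW dom rho sts js adm; rewrite /exact_step exchange_big /=.
under [leRHS]eq_bigr do rewrite -(sum_relaxed_type_value W _ _ q1 lj).
rewrite [leRHS]exchange_big /=; apply: ler_sum => a _; rewrite -!mulr_sumr.
by apply: ler_wpM2l => //; exact: type_value_dominated.
Qed.

Variables (b : nat -> J -> R) (q : nat -> option J * option J -> R).

Fixpoint exact_value n t : R -> socs_state (J := J) -> R :=
  if n is n'.+1 then exact_step (b t) (q t) (exact_value n' t.+1)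
  else fun r _ => Num.max 0 r.

Let be t := (B j)^-1 * b t j.
Let p t := one_way_prob (q t).
Let c t := half_two_way_prob (q t).

Lemma exact_value_dominated n t : 0 < B j ->
  (forall i, (t <= i < t + n)%N -> valid_step p c be i) ->
  (forall i, (t <= i < t + n)%N -> (forall a, 0 <= q i a) /\ \sum_a q i a = 1) ->
  dominated (exact_value n t) (relaxed_value p c be n t).
Proof.
move=> B0; elim: n t => [|n IH] t vs qs; first by move=> *; exact: lexx.
have tt : (t <= t < t + n.+1)%N by rewrite leqnn -[ltnLHS]addn0 ltn_add2l.
have S i : (t.+1 <= i < t.+1 + n)%N -> (t <= i < t + n.+1)%N.
  by move=> /andP[ti it]; rewrite (ltnW ti) -addSnnS.
have [_ _ _ _ /andP[be0 _]] := vs t tt; have [q0 q1] := qs t tt.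
apply: exact_step_dominated => //.
- by rewrite [(B j)^-1 * _]mulrC ler_pdivlMr.
- by apply: good_relaxed_value => i /S /vs.
- by apply: IH => i /S; [exact: vs | exact: qs].
Qed.

Lemma exact_value_le n : 0 < B j ->
  (forall i, (i < n)%N -> valid_step p c be i) ->
  (forall i, (i < n)%N -> (forall a, 0 <= q i a) /\ \sum_a q i a = 1) ->
  exact_value n 0 1 (fun=> [::]) <= g (\sum_(i < n) (p i + c i) * be i).
Proof.
move=> B0 vs qs; apply: le_trans (relaxed_value_le vs).
have dom : dominated (exact_value n 0) (relaxed_value p c be n 0).
  exact: exact_value_dominated.
(* Initially nothing depends on the bits: both sums are the same positive multiple of the two
   values. *)
have := dom (fun=> 1) (fun _ _ => [::]) [::]; rewrite !sumr_const.
rewrite lerMn2r => /(_ _)/orP[| |//].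
  by split=> // k _; left; exists [::].
by rewrite -leqn0 leqNgt => /negP[]; apply/card_gt0P; exists [ffun=> true].
Qed.

End DiscreteProcess.

(** * The process on a finite product space *)

Section ProductMean.
Context {R : realType} {K : finType} {T : nat}.
Variable p : 'I_T -> K -> R.
Implicit Types (om : {ffun 'I_T -> K}) (Phi : {ffun 'I_T -> K} -> R).

Definition product_weight om := \prod_i p i (om i).

Definition product_mean Phi := \sum_om product_weight om * Phi om.

Hypothesis p1 : forall i, \sum_k p i k = 1.

(** Exchanging the coordinate [om i] with an independent copy [k] is an involution that preserves
    the joint weight. *)
Lemma product_mean_resample i Phi :
  product_mean Phi = product_mean (fun om => \sum_k p i k * Phi (set_at om i k)).
Proof.
rewrite /product_mean; under [RHS]eq_bigr do rewrite mulr_sumr.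
rewrite pair_big /=.
pose h (x : {ffun 'I_T -> K} * K) := (set_at x.1 i x.2, x.1 i).
have hK : involutive h.
  by move=> [om k]; rewrite /h /= set_atK set_at_id set_atE eqxx.
rewrite (reindex_inj (inv_inj hK)) /=.
transitivity (\sum_(x : {ffun 'I_T -> K} * K) product_weight x.1 * Phi x.1 * p i x.2).
  rewrite -(pair_big xpredT xpredT (fun om k => product_weight om * Phi om * p i k)) /=.
  by apply: eq_bigr => om _; rewrite -mulr_sumr p1 mulr1.
apply: eq_bigr => -[om k] _ /=.
rewrite set_atK set_at_id mulrA mulrAC; congr (_ * _).
rewrite /product_weight (bigD1 i) //= [in RHS](bigD1 i) //= set_atE eqxx.
rewrite [RHS]mulrAC mulrAC [p i k * _]mulrC; congr (_ * _).
by apply: eq_bigr => l li; rewrite set_atE (negPf li).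
Qed.

Lemma product_mean_cst x : product_mean (fun=> x) = x.
Proof.
rewrite /product_mean -mulr_suml.
have <- := bigA_distr_bigA p; rewrite big1 ?mul1r// => i _; exact: p1.
Qed.

End ProductMean.

Section RunMean.
Context {R : realType} {d : Order.disp_t} {J : finOrderType d}.
Variables (B : J -> R) (j : J) (b : nat -> J -> R).

Let K : finType := ((option J * option J) * bool * bool)%type.

Section Run.
Variable ka : nat -> K.

Fixpoint run (t : nat) : R * socs_state (J := J) :=
  if t is t'.+1 then
    let S := run t' in
    let o := discrete_step B (b t') S.2 (ka t').1.1 (ka t').1.2 (ka t').2 in
    (S.1 - loss B j (b t') o.1, o.2)
  else (1, fun=> [::]).

End Run.

Lemma eq_run ka ka' n : (forall t, (t < n)%N -> ka t = ka' t) ->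
  run ka n = run ka' n.
Proof.
elim: n => //= n IH e; rewrite IH ?e// => t tn; apply: e; exact: ltnW.
Qed.

Lemma unused_fractionE mu eta pick coin T :
  unused_fraction B b mu eta pick coin T j =
  Num.max 0 (run (fun t => (agent_at (mu t) (eta t), agent_at (mu t) (eta t + 2^-1),
                            pick t, coin t)) T).1.
Proof.
set ka := fun t => _; rewrite /unused_fraction; congr (Num.max 0 _).
have st t : ocs_state B b mu eta pick coin t = (run ka t).2.
  by elim: t => //= t ->; rewrite ocs_stepE.
elim: T => [|T IH] /=; first by rewrite big_ord0 mulr0 subr0.
rewrite big_mkcond big_ord_recr -big_mkcond /= mulrDr opprD addrA IH; congr (_ - _).
rewrite /ocs_alloc st ocs_stepE /loss; case: ifP => _ //.
by rewrite mulr0.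
Qed.

Variable T : nat.

Definition extend (om : {ffun 'I_T -> K}) (t : nat) : K :=
  if insub t is Some i then om i else (None, None, true, true).

Lemma extendE (om : {ffun 'I_T -> K}) (i : 'I_T) : extend om i = om i.
Proof. by rewrite /extend valK. Qed.

Variable q : nat -> option J * option J -> R.
Hypothesis q1 : forall t, (t < T)%N -> \sum_a q t a = 1.

Definition step_law (i : 'I_T) (k : K) : R := q i k.1.1 / 4.

Lemma sum_step_law i (F : K -> R) : \sum_k step_law i k * F k =
  \sum_a q i a * ((\sum_(pick : bool) \sum_(coin : bool) F (a, pick, coin)) / 4).
Proof.
transitivity (\sum_a \sum_(pick : bool) \sum_(coin : bool)
    step_law i (a, pick, coin) * F (a, pick, coin)).
  by rewrite !pair_big /=; apply: eq_bigr => -[[a pick] coin].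
apply: eq_bigr => a _; rewrite mulrA mulrAC mulr_sumr.
by apply: eq_bigr => pick _; rewrite mulr_sumr.
Qed.

Lemma step_law1 i : \sum_k step_law i k = 1.
Proof.
under eq_bigr do rewrite -[step_law _ _]mulr1.
rewrite (sum_step_law i (fun=> 1)) -[RHS](q1 (ltn_ord i)); apply: eq_bigr => a _.
by rewrite !big_bool /=; lra.
Qed.

(** [Phi i] samples the first [i] steps and evaluates the others by the recursion. Resampling
    coordinate [i] shows that [Phi i] and [Phi i.+1] have equal means, from the full run at [T] down
    to the pure recursion at 0. *)
Lemma product_mean_run :
  product_mean step_law (fun om => Num.max 0 (run (extend om) T).1) =
  exact_value B j b q T 0 1 (fun=> [::]).
Proof.
pose Phi i (om : {ffun 'I_T -> K}) :=
  exact_value B j b q (T - i) i (run (extend om) i).1 (run (extend om) i).2.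
have -> : (fun om => Num.max 0 (run (extend om) T).1) = Phi T.
  by apply/funext => om; rewrite /Phi subnn.
suff H i : (i <= T)%N -> product_mean step_law (Phi i) =
    exact_value B j b q T 0 1 (fun=> [::]) by exact: H.
elim: i => [|i IH] iT.
  rewrite -[RHS](product_mean_cst step_law1); congr product_mean.
  by apply/funext => om; rewrite /Phi subn0.
rewrite -IH ?(ltnW iT)// (product_mean_resample step_law1 (Ordinal iT)).
congr product_mean; apply/funext => om; rewrite sum_step_law {2}/Phi.
rewrite -(subSS i T) subSn//= /exact_step; apply: eq_bigr => a _.
congr (_ * (_ / 4)); apply: eq_bigr => pk _; apply: eq_bigr => cn _.
rewrite /Phi /next_value /=.
have -> : run (extend (set_at om (Ordinal iT) (a, pk, cn))) i = run (extend om) i.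
  apply: eq_run => t ti; have tT := ltn_trans ti iT.
  rewrite -[t]/(val (Ordinal tT)) !extendE set_atE.
  by case: eqP => // -[e]; rewrite e ltnn in ti.
have -> : extend (set_at om (Ordinal iT) (a, pk, cn)) i = (a, pk, cn).
  by rewrite -[i]/(val (Ordinal iT)) extendE set_atE eqxx.
by [].
Qed.

End RunMean.

(** * The law of the types *)

Section FiniteValued.
Context {R : realType} {d : measure_display} {Om : measurableType d}.
Variable P : probability Om R.
Context {K : finType}.
Variable X : Om -> K.
Hypothesis mX : forall k, measurable (X @^-1` [set k]).

Lemma integral_finite_valued (Phi : K -> R) : (forall k, 0 <= Phi k) ->
  (\int[P]_w (Phi (X w))%:E = (\sum_k Phi k * fine (P (X @^-1` [set k])))%:E)%E.
Proof.
move=> Phi0.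
have e w : ((Phi (X w))%:E =
    \sum_(k : K) (Phi k)%:E * (\1_(X @^-1` [set k]) w)%:E)%E.
  rewrite (bigD1 (X w)) //= indicE mem_set//= mule1 big1 ?adde0// => k kX.
  by rewrite indicE memNset ?mule0// => /= e; rewrite e eqxx in kX.
have mi k : measurable_fun setT (fun w => (\1_(X @^-1` [set k]) w)%:E : \bar R).
  by apply/measurable_EFinP; exact: measurable_indic.
under eq_integral do rewrite e.
rewrite ge0_integral_sum//=.
- rewrite -sumEFin; apply: eq_bigr => k _.
  rewrite ge0_integralZl_EFin//= integral_indic// setIT EFinM.
  by rewrite fineK// fin_num_measure.
- by move=> k; apply: emeasurable_funM => //; exact: measurable_cst.
- by move=> k w _; rewrite mule_ge0// lee_fin.
Qed.

Lemma sum_fiber (E : pred K) : measurable [set w | E (X w)] ->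
  \sum_(k | E k) fine (P (X @^-1` [set k])) = fine (P [set w | E (X w)]).
Proof.
move=> mE; have := @integral_finite_valued (fun k => (E k)%:R) (fun=> ler0n _ _).
rewrite (_ : (\int[P]_w _)%E = P [set w | E (X w)]); last first.
  rewrite -[in RHS](setIT [set w | E (X w)]) -integral_indic//; apply: eq_integral => w _.
  rewrite indicE; congr (_%:R%:E); case: (boolP (E (X w))) => Ew.
    by rewrite mem_set.
  by rewrite memNset//=; exact/negP.
move=> ->; rewrite /= big_mkcond; apply: eq_bigr => k _.
by case: (E k); rewrite ?mul1r ?mul0r.
Qed.

End FiniteValued.

(** * The uniform law on [0, 1/2) *)

Section UniformHalf.
Context {R : realType}.
Implicit Types (A : set R) (x y : R).

Let U := uniform_prob (@half_interval R).

Lemma uniform_halfE A : measurable A ->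
  U A = (2%:E * lebesgue_measure (A `&` `[0%R, 2^-1%R]))%E.
Proof.
move=> mA; rewrite /U /uniform_prob integral_uniform_pdf.
rewrite (eq_integral (fun=> 2%:E)); last first.
  move=> x; rewrite inE/= in_itv/= /uniform_pdf => -[_ ->].
  by rewrite subr0 invrK.
by rewrite integral_cst//; exact: measurableI.
Qed.

(** The law is carried by the closed interval, so [A] may still contain the endpoint 1/2, which has
    measure zero. *)
Lemma uniform_half_null A : measurable A ->
  (forall x, 0 <= x < 2^-1 -> ~ A x) -> U A = 0%E.
Proof.
move=> mA nA; rewrite uniform_halfE//.
suff -> : lebesgue_measure (A `&` `[0%R, 2^-1%R]) = 0%E by rewrite mule0.
have mA' : measurable (A `&` `[0%R, 2^-1%R]) by exact: measurableI.
have m1 : measurable [set 2^-1 : R] by exact: measurable_set1.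
apply/eqP; rewrite -measure_le0 -(lebesgue_measure_set1 (2^-1 : R)).
rewrite le_measure ?inE// => x [Ax /=].
rewrite in_itv/= => /andP[x0]; rewrite le_eqVlt => /orP[/eqP//|xh].
by case: (nA x) => //; rewrite x0.
Qed.

(* The two intervals are the parts of [x, y) below and above 1/2, the latter
   translated into [0, 1/2). *)
Lemma uniform_half_itv x y : 0 <= x -> x <= y -> y <= 1 ->
  fine (U `[x, y[) + fine (U `[x - 2^-1, y - 2^-1[) = 2 * (y - x).
Proof.
move=> x0 xy y1; rewrite !uniform_halfE//.
have co (a b : R) : a <= b -> lebesgue_measure (`[a, b[ : set R) = (b - a)%:E.
  rewrite lebesgue_measure_itv /= lte_fin; case: ltgtP => // -> _.
  by rewrite subrr.
have cc (a b : R) : a <= b -> lebesgue_measure (`[a, b] : set R) = (b - a)%:E.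
  rewrite lebesgue_measure_itv /= lte_fin; case: ltgtP => // -> _.
  by rewrite subrr.
set A := _ `&` _; set A' := _ `&` _.
have AE (S : set R) : (forall z, (x <= z < y) && (0 <= z <= 2^-1) <-> S z) -> A = S.
  move=> AS; apply/seteqP; split=> z; rewrite /A /= !in_itv /=.
    by move=> [h1 h2]; apply/AS; rewrite h1.
  by move=> /AS/andP.
have AE' (S : set R) : (forall z, (x - 2^-1 <= z < y - 2^-1) && (0 <= z <= 2^-1) <-> S z) ->
    A' = S.
  move=> AS; apply/seteqP; split=> z; rewrite /A' /= !in_itv /=.
    by move=> [h1 h2]; apply/AS; rewrite h1.
  by move=> /AS/andP.
have [yh|yh] := leP y 2^-1.
  rewrite (AE `[x, y[%classic) ?(AE' set0).
  - by rewrite co// measure0 mule0 -EFinM /= addr0.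
  - by move=> z /=; split => // ?; lra.
  - by move=> z /=; rewrite in_itv /=; split; lra.
have [xh|xh] := leP x 2^-1.
  rewrite (AE `[x, 2^-1]%classic) ?(AE' `[0, y - 2^-1[%classic).
  - by rewrite co ?cc//; [rewrite -!EFinM /=; lra | lra].
  - by move=> z /=; rewrite in_itv /=; split; lra.
  - by move=> z /=; rewrite in_itv /=; split; lra.
rewrite (AE set0) ?(AE' `[x - 2^-1, y - 2^-1[%classic).
- by rewrite co ?measure0 ?mule0 -?EFinM /=; lra.
- by move=> z /=; rewrite in_itv /=; split; lra.
- by move=> z /=; split => // ?; lra.
Qed.

End UniformHalf.

(** * The intervals of the agents and the resulting probabilities of types *)

Section Agents.
Context {R : realType} {d : Order.disp_t} {J : finOrderType d}.
Variable mu : J -> R.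
Hypotheses (mu0 : forall i, 0 <= mu i) (mu1 : \sum_i mu i = 1).
Implicit Types (x : R) (i k : J).

Let lo i := \sum_(k | (k < i)%O) mu k.
Let hi i := \sum_(k | (k <= i)%O) mu k.

Let hiE i : hi i = lo i + mu i.
Proof.
rewrite /hi (bigD1 i) //= addrC; congr (_ + _); apply: eq_bigl => k.
by rewrite lt_neqAle andbC.
Qed.

Let sum_le (P Q : pred J) : (forall i, P i -> Q i) ->
  \sum_(i | P i) mu i <= \sum_(i | Q i) mu i.
Proof.
move=> PQ; rewrite big_mkcond [leRHS]big_mkcond; apply: ler_sum => i _.
by case: (boolP (P i)) => [/PQ ->|_] //; case: ifP.
Qed.

Let lo_ge0 i : 0 <= lo i. Proof. exact: sumr_ge0. Qed.
Let hi_le1 i : hi i <= 1. Proof. by rewrite -mu1; exact: sum_le. Qed.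

Let hi_le_lo i k : (i < k)%O -> hi i <= lo k.
Proof. by move=> ik; apply: sum_le => l li; exact: le_lt_trans ik. Qed.

(** The intervals are pairwise disjoint, so [pick] has at most one candidate. *)
Lemma agent_atE x i : (agent_at mu x == Some i) = (lo i <= x < hi i).
Proof.
rewrite /agent_at; case: pickP => [k /andP[lok hik]|none]; last first.
  by rewrite none; apply/eqP.
apply/eqP/idP => [[<-]|/andP[loi hii]]; first by rewrite lok.
congr Some; apply/eqP; rewrite eq_le; case: leP => /= [_|ik].
  case: leP => // ki; have := hi_le_lo ki; rewrite -/(lo i) -/(hi k) in lok hik *; lra.
have := hi_le_lo ik; rewrite -/(lo k) -/(hi i) in lok hik *; lra.
Qed.

(** Take the least [i] with [x < hi i]; it exists because the last agent has [hi m = 1]. Then either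
    [i] is the first agent and [lo i = 0], or [lo i] is at most [hi] of its predecessor, which is at
    most [x] by minimality. *)
Lemma agent_at_cover x : 0 <= x < 1 -> agent_at mu x <> None.
Proof.
move=> /andP[x0 x1]; rewrite /agent_at; case: pickP => // none _.
have [i1 _] : exists i : J, true.
  apply: contrapT => nJ; move: x1; rewrite -mu1 big1 ?ltNge ?x0// => i.
  by case: nJ; exists i.
case: (arg_maxP (fun i : J => i) (isT : xpredT i1)) => m _ mmax.
have xm : x < hi m.
  by apply: (lt_le_trans x1); rewrite -mu1; apply: sum_le => i _; exact: mmax.
case: (@arg_minP _ _ _ m (fun i => x < hi i) (fun i : J => i) xm) => i xi imin.
have : lo i <= x.
  have [k0 k0i|ni] := pickP (fun k => (k < i)%O); last by rewrite /lo big_pred0.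
  case: (@arg_maxP _ _ _ k0 (fun k => (k < i)%O) (fun i : J => i) k0i) => k ki kmax.
  apply: (@le_trans _ _ (hi k)); first by apply: sum_le => l; exact: kmax.
  by rewrite leNgt; apply/negP => /imin; rewrite leNgt ki.
by move=> xl; have := none i; rewrite -/(lo i) -/(hi i) xl xi.
Qed.

Definition type_at x := (agent_at mu x, agent_at mu (x + 2^-1)).

Definition type_law (a : option J * option J) : R :=
  fine (uniform_prob half_interval [set x | type_at x = a]).

Let agent_itv h i : [set x | agent_at mu (x + h) = Some i] = `[lo i - h, hi i - h[%classic.
Proof.
apply/seteqP; split=> x /=; rewrite in_itv /=.
  by move=> /eqP; rewrite agent_atE; lra.
by move=> xi; apply/eqP; rewrite agent_atE; lra.
Qed.

Let measurable_agent_at h o : measurable [set x | agent_at mu (x + h) = o].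
Proof.
have mS i : measurable [set x | agent_at mu (x + h) = Some i] by rewrite agent_itv.
case: o => // ; rewrite (_ : [set _ | _] = ~` \bigcup_(i in [set: J])
    [set x | agent_at mu (x + h) = Some i]).
  by apply: measurableC; apply: fin_bigcup_measurable => //; exact: finite_finset.
apply/seteqP; split=> x /=; first by move=> e [i _ /=]; rewrite e.
by move=> n; case e: (agent_at _ _) => [i|//]; case: n; exists i.
Qed.

Lemma measurable_type_at a : measurable [set x | type_at x = a].
Proof.
rewrite (_ : [set _ | _] = [set x | agent_at mu (x + 0) = a.1] `&`
                           [set x | agent_at mu (x + 2^-1) = a.2]).
  by apply: measurableI; exact: measurable_agent_at.
case: a => a1 a2; rewrite /type_at; apply/seteqP; split=> x /=; rewrite addr0.
  by case.
by case=> -> ->.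
Qed.

Lemma measurable_type_pred (E : pred (option J * option J)) :
  measurable [set x | E (type_at x)].
Proof.
rewrite (_ : [set _ | _] = \bigcup_(a in [set a | E a]) [set x | type_at x = a]).
  by apply: fin_bigcup_measurable => [|a _]; [exact: finite_finset | exact: measurable_type_at].
by apply/seteqP; split=> x /= => [Ex|[a Ea ->//]]; exists (type_at x).
Qed.

Lemma type_law_ge0 a : 0 <= type_law a.
Proof. by apply: fine_ge0; exact: measure_ge0. Qed.

Lemma sum_type_law (E : pred (option J * option J)) :
  \sum_(a | E a) type_law a =
  fine (uniform_prob half_interval [set x | E (type_at x)]).
Proof.
apply: (@sum_fiber _ _ _ (uniform_prob half_interval)) => *.
- exact: measurable_type_at.
- exact: measurable_type_pred.
Qed.

Lemma type_law1 : \sum_a type_law a = 1.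
Proof.
rewrite sum_type_law (_ : [set _ | _] = setT); last by apply/seteqP; split.
by rewrite probability_setT.
Qed.

Lemma sum_type_law_null (E : pred (option J * option J)) :
  (forall x, 0 <= x < 2^-1 -> ~~ E (type_at x)) -> \sum_(a | E a) type_law a = 0.
Proof.
move=> nE; rewrite sum_type_law uniform_half_null//.
  exact: measurable_type_pred.
by move=> x /nE/negP.
Qed.

Variable j : J.
Let p := one_way_prob j type_law.
Let c := half_two_way_prob j type_law.

(** The events that [eta] and that [eta + 1/2] fall into the interval of [j] have probabilities
    adding up to [2 * mu j]; one-way types count twice in this sum, two-way types once. *)
Lemma type_law_mean : p + c = mu j.
Proof.
have l0 : 0 <= lo j := lo_ge0 j.
have lh : lo j <= hi j by rewrite hiE; have := mu0 j; lra.
have := uniform_half_itv l0 lh (hi_le1 j).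
have e1 : [set x | (type_at x).1 == Some j] = `[lo j, hi j[%classic.
  by apply/seteqP; split=> x /=; rewrite agent_atE in_itv.
have e2 : [set x | (type_at x).2 == Some j] = `[lo j - 2^-1, hi j - 2^-1[%classic.
  by rewrite -agent_itv; apply/seteqP; split=> x /= /eqP.
rewrite -e1 -e2 -(sum_type_law (fun a => a.1 == Some j)).
rewrite -(sum_type_law (fun a => a.2 == Some j)) => e.
(* A pair with a missing agent can meet [j] in one coordinate without being a two-way type; such
   pairs have probability zero. *)
pose bad (a : option J * option J) := (a.1 == None) || (a.2 == None).
have bad0 : \sum_(a | bad a) type_law a = 0.
  apply: sum_type_law_null => x x01; rewrite /bad negb_or; apply/andP; split.
    by apply/eqP; apply: agent_at_cover; lra.
  by apply/eqP; apply: agent_at_cover; lra.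
have badE a : bad a -> type_law a = 0.
  move=> ba; apply/eqP; rewrite eq_le type_law_ge0 andbT -bad0 (bigD1 a)//=.
  by rewrite lerDl sumr_ge0// => *; exact: type_law_ge0.
have : \sum_(a | a.1 == Some j) type_law a + \sum_(a | a.2 == Some j) type_law a =
    2 * p + 2 * c.
  have -> : 2 * p = \sum_(a | one_way j a) 2 * type_law a by rewrite big_pred1_eq.
  have -> : 2 * c = \sum_(a | two_way j a) type_law a.
    by rewrite /c /half_two_way_prob mulrC divfK.
  rewrite (big_mkcond (one_way j)) (big_mkcond (two_way j)).
  rewrite (big_mkcond (fun a => a.1 == Some j)) (big_mkcond (fun a => a.2 == Some j)).
  rewrite -!big_split /=; apply: eq_bigr => a _.
  case: (boolP (bad a)) => [ba|].
    by rewrite badE// mulr0; do !case: ifP.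
  rewrite /bad /one_way /two_way; case: a => [[i|] [k|]] //= _.
  rewrite -[(Some i, Some k) == _]/((i == j) && (k == j)).
  rewrite -![Some _ == Some j]/(_ == j).
  have [->|ij] := eqVneq i j; have [->|kj] := eqVneq k j; rewrite /= ?eqxx /=.
  - ring.
  - ring.
  - by rewrite ij.
  - by rewrite andbF.
rewrite e hiE; lra.
Qed.

Lemma one_way_prob_ge0 : 0 <= p.
Proof. exact: type_law_ge0. Qed.

Lemma half_two_way_prob_ge0 : 0 <= c.
Proof.
by rewrite /c /half_two_way_prob divr_ge0// sumr_ge0// => *; exact: type_law_ge0.
Qed.

Let other a := ~~ one_way j a && ~~ two_way j a.

Let other_prob : p + 2 * c + \sum_(a | other a) type_law a = 1.
Proof.
rewrite -[RHS]type_law1 [RHS](bigID (one_way j)) /= big_pred1_eq -addrA; congr (_ + _).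
rewrite [RHS](bigID (two_way j)) /=; congr (_ + _).
  rewrite /c /half_two_way_prob mulrC divfK//; apply: eq_bigl => a.
  by case: (boolP (one_way j a)) => // /eqP->; rewrite /two_way eqxx.
Qed.

Lemma type_prob_le1 : p + 2 * c <= 1.
Proof.
rewrite -[leRHS]other_prob lerDl sumr_ge0// => *; exact: type_law_ge0.
Qed.

(* If [x] and [x + 1/2] both lie in the interval of [j], then every pair
   [y], [y + 1/2] with [0 <= y < 1/2] meets this interval. *)
Lemma one_way_prob_or : p = 0 \/ p + 2 * c = 1.
Proof.
have [[x [x0 xj]]|nx] := pselect (exists x, 0 <= x < 2^-1 /\ one_way j (type_at x)).
  right; rewrite -[RHS]other_prob (_ : \sum_(a | _) _ = 0) ?addr0//.
  apply: sum_type_law_null => y y0; rewrite /other negb_and !negbK.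
  move: xj; rewrite /one_way /two_way /type_at xpair_eqE !agent_atE.
  move=> /andP[/andP[x1 x2] /andP[x3 x4]].
  rewrite xpair_eqE.
  have cov z : 0 <= z < 1 -> exists i, agent_at mu z = Some i.
    by move=> /agent_at_cover; case: (agent_at mu z) => // i _; exists i.
  have [i iE] : exists i, agent_at mu y = Some i by apply: cov; lra.
  have [k kE] : exists k, agent_at mu (y + 2^-1) = Some k by apply: cov; lra.
  rewrite iE kE -![Some _ == Some j]/(_ == j).
  have : (i == j) || (k == j).
    have [xy|yx] := leP x y.
      have : agent_at mu y == Some j by rewrite agent_atE; lra.
      by rewrite iE => /eqP[->]; rewrite eqxx.
    have : agent_at mu (y + 2^-1) == Some j by rewrite agent_atE; lra.
    by rewrite kE => /eqP[->]; rewrite eqxx orbT.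
  by have [->|ij] := eqVneq i j; have [kE'|kj] := eqVneq k j => //= _; rewrite ?kE' ?ij.
left; rewrite /p /one_way_prob -(big_pred1_eq +%R (Some j, Some j) type_law).
apply: sum_type_law_null => x x0; apply/negP => xj; apply: nx; exists x; split=> //.
Qed.

End Agents.

(** * Transfer from the probability space to the finite process *)

Lemma probability_bool (R : realType) (d : measure_display) (Om : measurableType d)
    (P : probability Om R) (X : {RV P >-> bool}) (v : bool) :
  distribution P X [set true] = (2^-1)%:E -> P (X @^-1` [set v]) = (2^-1)%:E.
Proof.
move=> Xt; case: v; first exact: Xt.
have -> : X @^-1` [set false] = ~` (X @^-1` [set true]).
  by apply/seteqP; split=> w /=; case: (X w).
rewrite probability_setC//; last exact: measurable_funPTI.
rewrite (_ : P _ = (2^-1)%:E); last exact: Xt.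
by rewrite -EFinD; congr EFin; lra.
Qed.

Theorem theorem5p7 (R : realType)
  (dJ : Order.disp_t) (J : finOrderType dJ) (T : nat)
  (B : J -> R) (b mu : nat -> J -> R)
  (B_gt0 : forall j, 0 < B j)
  (b_ge0 : forall t j, (t < T)%N -> 0 <= b t j)
  (b_le : forall t j, (t < T)%N -> b t j <= B j)
  (mu_ge0 : forall t j, (t < T)%N -> 0 <= mu t j)
  (mu_sum1 : forall t, (t < T)%N -> \sum_j mu t j = 1)
  (d : measure_display) (Omega : measurableType d) (P : probability Omega R)
  (eta : nat -> {RV P >-> R}) (pick coin : nat -> {RV P >-> bool})
  (fresh : fresh_randomness T eta pick coin) (j : J) :
  ('E_P[fun w : Omega => unused_fraction B b mu (fun t => eta t w)
          (fun t => pick t w) (fun t => coin t w) T j]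
   <= (g (\sum_(t < T) mu t j * b t j / B j))%:E)%E.
Proof.
move: fresh => [etaU pickU coinU indep].
pose K : finType := ((option J * option J) * bool * bool)%type.
pose X w : {ffun 'I_T -> K} :=
  [ffun t : 'I_T => (type_at (mu t) (eta t w), pick t w, coin t w)].
pose q t := type_law (mu t).
pose A om (i : 'I_T + 'I_T + 'I_T) : set Omega := match i with
  | inl (inl t) => eta t @^-1` [set x | type_at (mu t) x = (om t : K).1.1]
  | inl (inr t) => pick t @^-1` [set (om t).1.2]
  | inr t => coin t @^-1` [set (om t).2]
  end.
pose S : {set 'I_T + 'I_T + 'I_T} := [set: _]%SET.
have inS i : i \in S by rewrite finset.in_setT.
(* A fiber of [X] constrains each of the independent sources separately, so its probability is a
   product. *)
have fiberE om : X @^-1` [set om] = \bigcap_(i in [set i | i \in S]) A om i.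
  apply/seteqP; split=> w.
    by move=> /= <- [[t|t]|t] _ /=; rewrite ffunE.
  move=> Aw; apply/ffunP => t; rewrite ffunE.
  have := Aw (inl (inl t)) (inS _); have := Aw (inl (inr t)) (inS _).
  have := Aw (inr t) (inS _); rewrite /A /= => -> -> ->.
  by case: (om t) => [[]].
have mty t : (t < T)%N -> forall a, measurable [set x | type_at (mu t) x = a].
  by move=> tT a; apply: measurable_type_at => i; exact: mu_ge0.
have mA om i : measurable (A om i).
  case: i => [[t|t]|t] /=; try exact: measurable_funPTI.
  by apply: measurable_funPTI; exact: mty.
have mX om : measurable (X @^-1` [set om]).
  rewrite fiberE; apply: fin_bigcap_measurable => //.
have PX om : fine (P (X @^-1` [set om])) = product_weight (step_law q) om.
  rewrite fiberE indep; last first.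
    move=> [[t|t]|t] _ /=; eexists; try reflexivity => //.
    by apply: mty.
  rewrite (eq_bigl xpredT); last by move=> i; rewrite inS.
  rewrite !big_sumType /= (eq_bigr (fun t : 'I_T => (q t (om t).1.1)%:E)); last first.
    move=> t _; rewrite -[P _]/(distribution P (eta t) _) etaU//; last exact: mty.
    by rewrite fineK//; apply: fin_num_measure; exact: mty.
  rewrite [X in (_ * X * _)%E](eq_bigr (fun=> (2^-1)%:E)); last first.
    by move=> t _; apply: probability_bool; exact: pickU.
  rewrite [X in (_ * X)%E](eq_bigr (fun=> (2^-1)%:E)); last first.
    by move=> t _; apply: probability_bool; exact: coinU.
  rewrite !prodEFin /= -!big_split /=; apply: eq_bigr => t _.
  by rewrite /step_law; field.
have q1 t : (t < T)%N -> \sum_a q t a = 1.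
  by move=> tT; apply: type_law1 => i; exact: mu_ge0.
have -> : ('E_P[fun w : Omega => unused_fraction B b mu (fun t => eta t w)
          (fun t => pick t w) (fun t => coin t w) T j] =
    (exact_value B j b q T 0 1 (fun=> [::]))%:E)%E.
  rewrite unlock -(product_mean_run B j b q1).
  pose Phi (om : {ffun 'I_T -> K}) : R := Num.max 0 (run B j b (extend om) T).1.
  rewrite (eq_integral (fun w => (Phi (X w))%:E)); last first.
    move=> w _; rewrite unused_fractionE (@eq_run _ _ _ _ _ _ _ (extend (X w)))// => t tT.
    by have := extendE (X w) (Ordinal tT); rewrite ffunE /= => ->.
  rewrite integral_finite_valued//; last by move=> om; rewrite le_max lexx.
  by congr EFin; apply: eq_bigr => om _; rewrite PX mulrC.
rewrite lee_fin.
have beE t : (B j)^-1 * b t j = b t j / B j by rewrite mulrC.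
apply: (le_trans (exact_value_le (b := b) (q := q) (n := T) (B_gt0 j) _ _)).
- move=> t tT.
  have m0 i := mu_ge0 t i tT; have m1 := mu_sum1 t tT.
  split.
  + exact: one_way_prob_ge0.
  + exact: half_two_way_prob_ge0.
  + exact: type_prob_le1.
  + exact: one_way_prob_or.
  + rewrite beE divr_ge0 ?b_ge0 ?(ltW (B_gt0 j))//=.
    by rewrite ler_pdivrMr// mul1r b_le.
- by move=> t tT; split; [move=> a; exact: type_law_ge0 | exact: q1].
- rewrite le_eqVlt; apply/orP; left; apply/eqP; congr g; apply: eq_bigr => t _.
  rewrite type_law_mean ?beE ?mulrA//; last exact: mu_sum1.
  by move=> i; exact: mu_ge0.
Qed.
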